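(* Consider the linear model $Y=X\beta+\epsilon$ described in the context. Choose $\tau,a>0$, put $\lambda_{p,\tau}:=(\sqrt{1+a}+\tau^{-1})\sqrt{2\log p/n}$, and let $\beta_{\rm init}$ be the Dantzig selector with parameter $\lambda_n=\lambda_{p,\tau}\sigma$. Suppose $\beta$ is $s$-sparse with $\delta_{2s}+\theta_{s,2s}<1-\tau$. Let $C_1$ be the constant defined in the context, let $C_4>C_1$ be a constant, and let the threshold $t_0$ be chosen in the range $(C_1\lambda_{p,\tau}\sigma,\ C_4\lambda_{p,\tau}\sigma]$. Let $\hat\beta$ be the Gauss-Dantzig selector: the ordinary least squares estimator based on $\{j:|\beta_{j,\rm init}|\ge t_0\}$. Then with probability at least $1-(\sqrt{\pi\log p}\,p^a)^{-1}$, the selected model $I:=\mathrm{supp}(\hat\beta)$ satisfies $$|I|\le 2s_0\quad\text{and}\quad |I\setminus S|\le s_0\le s,$$ and $$\|\hat\beta-\beta\|_2^2\le 2C_3^2\log p\Bigl(\frac{\sigma^2}{n}+\sum_{i=1}^p\min\bigl(\beta_i^2,\sigma^2/n\bigr)\Bigr),$$ where $$C_3^2=3(\sqrt{1+a}+\tau^{-1})^2\bigl((C_0'+C_4)^2+1\bigr)+\frac{4(1+a)}{\Lambda_{\min}^2(2s_0)} .$$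
   Context: Model. $p\ge n$; $X$ is a fixed real $n\times p$ matrix whose columns all have $\ell_2$ norm $\sqrt n$; $\beta\in\mathbb R^p$; $\epsilon\sim N(0,\sigma^2I_n)$ with $\sigma>0$; $Y=X\beta+\epsilon$; $S=\mathrm{supp}(\beta)=\{j:\beta_j\ne0\}$. A vector is $m$-sparse if it has at most $m$ nonzero entries. For $T\subseteq\{1,\dots,p\}$, $X_T$ is the submatrix of columns indexed by $T$. The ordinary least squares (OLS) estimator based on $I$ is $\hat\beta_I=(X_I^TX_I)^{-1}X_I^TY$ on $I$ and zero outside $I$. $s_0$ is the smallest integer with $\sum_{i=1}^p\min(\beta_i^2,\lambda^2\sigma^2)\le s_0\lambda^2\sigma^2$, where $\lambda=\sqrt{2\log p/n}$. Dantzig selector with parameter $\lambda_n$: a minimizer of $\|b\|_1$ over $b\in\mathbb R^p$ subject to $\|\frac1nX^T(Y-Xb)\|_\infty\le\lambda_n$. Restricted isometry constant $\delta_m$: smallest number with $(1-\delta_m)\|v\|_2^2\le\|X_Tv\|_2^2/n\le(1+\delta_m)\|v\|_2^2$ for all $|T|\le m$, $v\in\mathbb R^{|T|}$. Restricted orthogonality constant $\theta_{m,m'}$: smallest number with $|\langle X_Tc,X_{T'}c'\rangle|/n\le\theta_{m,m'}\|c\|_2\|c'\|_2$ for all disjoint $T,T'$ with $|T|\le m$, $|T'|\le m'$ and all $c,c'$. $\Lambda_{\min}(m)=\min\{\|Xv\|_2^2/(n\|v\|_2^2):v\ne0\ m\text{-sparse}\}$. Constants, with $\delta=\delta_{2s}$,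 $\theta=\theta_{s,2s}$: $$C_0=2\sqrt2\Bigl(1+\frac{1-\delta^2}{1-\delta-\theta}\Bigr)+\Bigl(1+\frac1{\sqrt2}\Bigr)\frac{(1+\delta)^2}{1-\delta-\theta},\quad C_0'=\frac{C_0}{1-\delta-\theta}+\frac{\theta(1+\delta)}{(1-\delta-\theta)^2},\quad C_1=C_0'+\frac{1+\delta}{1-\delta-\theta}.$$ *)

(* Defs.v *)
From HB Require Import structures.
From mathcomp Require Import all_boot all_order all_algebra.
From mathcomp Require Import all_classical all_reals all_analysis.

Set Implicit Arguments.
Unset Strict Implicit.
Unset Printing Implicit Defensive.

Import Order.TTheory GRing.Theory Num.Theory.
Import numFieldNormedType.Exports.

Local Open Scope classical_set_scope.
Local Open Scope ring_scope.

Definition l2norm (R : realType) (k : nat) (v : 'cV[R]_k) : R :=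
  Num.sqrt (\sum_i v i 0 ^+ 2).

Definition l1norm (R : realType) (k : nat) (v : 'cV[R]_k) : R :=
  \sum_i `|v i 0|.

Definition dotp (R : realType) (k : nat) (u v : 'cV[R]_k) : R :=
  \sum_i u i 0 * v i 0.

Definition supp (R : realType) (p : nat) (b : 'cV[R]_p) : {set 'I_p} :=
  [set j | b j 0 != 0]%SET.

Definition sparse (R : realType) (p m : nat) (b : 'cV[R]_p) : Prop :=
  (#|supp b| <= m)%N.

(* X_J; its k-th column is the column of X whose index is the k-th element of J
   in increasing order. *)
Definition subcols (R : realType) (n p : nat) (X : 'M[R]_(n, p))
    (J : {set 'I_p}) : 'M[R]_(n, #|J|) :=
  colsub (fun k : 'I_#|J| => enum_val k) X.

(* The vector of R^p that is v on J and zero outside J. *)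
Definition zero_extend (R : realType) (p : nat) (J : {set 'I_p})
    (v : 'cV[R]_#|J|) : 'cV[R]_p :=
  \col_j \sum_(k < #|J| | enum_val k == j) v k 0.

(* invmx is the inverse only when X_J^T X_J is invertible; otherwise it returns
   its argument. *)
Definition ols (R : realType) (n p : nat) (X : 'M[R]_(n, p)) (Y : 'cV[R]_n)
    (J : {set 'I_p}) : 'cV[R]_p :=
  let XJ := subcols X J in
  zero_extend (invmx (XJ^T *m XJ) *m (XJ^T *m Y)).

(* mx_norm is the maximum of the absolute values of the entries. *)
Definition dantzig_feasible (R : realType) (n p : nat) (X : 'M[R]_(n, p))
    (Y : 'cV[R]_n) (lam : R) (b : 'cV[R]_p) : Prop :=
  mx_norm (n%:R^-1 *: (X^T *m (Y - X *m b))) <= lam.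

Definition dantzig_selector (R : realType) (n p : nat) (X : 'M[R]_(n, p))
    (Y : 'cV[R]_n) (lam : R) (b : 'cV[R]_p) : Prop :=
  dantzig_feasible X Y lam b /\
  forall b', dantzig_feasible X Y lam b' -> l1norm b <= l1norm b'.

(* The infima below are attained, hence are the smallest such numbers, as soon
   as the defining condition is not vacuous.  When it is vacuous (m = 0 or p = 0; also
   m' = 0 or p = 1 for the orthogonality constant) every real number
   satisfies it and inf returns 0. *)
Definition restricted_isometry (R : realType) (n p : nat) (X : 'M[R]_(n, p))
    (m : nat) : R :=
  inf [set d : R | forall (J : {set 'I_p}) (v : 'cV[R]_#|J|), (#|J| <= m)%N ->
    (1 - d) * l2norm v ^+ 2 <= l2norm (subcols X J *m v) ^+ 2 / n%:R
      <= (1 + d) * l2norm v ^+ 2].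

Definition restricted_orthogonality (R : realType) (n p : nat)
    (X : 'M[R]_(n, p)) (m m' : nat) : R :=
  inf [set th : R | forall (J J' : {set 'I_p})
      (c : 'cV[R]_#|J|) (c' : 'cV[R]_#|J'|),
    [disjoint J & J']%B -> (#|J| <= m)%N -> (#|J'| <= m')%N ->
    `|dotp (subcols X J *m c) (subcols X J' *m c')| / n%:R
      <= th * l2norm c * l2norm c'].

(* For m = 0 the minimum is over the empty set and inf returns 0. *)
Definition Lambda_min (R : realType) (n p : nat) (X : 'M[R]_(n, p))
    (m : nat) : R :=
  inf [set l2norm (X *m v) ^+ 2 / (n%:R * l2norm v ^+ 2)
      | v in [set v : 'cV[R]_p | v != 0 /\ sparse m v]].

Definition universal_level (R : realType) (n p : nat) : R :=
  Num.sqrt (2 * ln p%:R / n%:R).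

Definition dantzig_level (R : realType) (n p : nat) (a tau : R) : R :=
  (Num.sqrt (1 + a) + tau^-1) * universal_level R n p.

(* The sum is nonnegative, so when universal_level and sigma are positive no
   negative integer satisfies the condition and k may range over nat. *)
Definition is_essential_sparsity (R : realType) (n p : nat) (beta : 'cV[R]_p)
    (sigma : R) (s0 : nat) : Prop :=
  let bound := universal_level R n p ^+ 2 * sigma ^+ 2 in
  let cond (k : nat) :=
    \sum_(i < p) Num.min (beta i 0 ^+ 2) bound <= k%:R * bound in
  cond s0 /\ forall k : nat, cond k -> (s0 <= k)%N.

Definition C0 (R : realType) (delta theta : R) : R :=
  2 * Num.sqrt 2 * (1 + (1 - delta ^+ 2) / (1 - delta - theta))
  + (1 + (Num.sqrt 2)^-1) * ((1 + delta) ^+ 2 / (1 - delta - theta)).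

Definition C0' (R : realType) (delta theta : R) : R :=
  C0 delta theta / (1 - delta - theta)
  + theta * (1 + delta) / (1 - delta - theta) ^+ 2.

Definition C1 (R : realType) (delta theta : R) : R :=
  C0' delta theta + (1 + delta) / (1 - delta - theta).

(* C_3^2, with Lmin standing for Lambda_min X (2 * s0).  If s0 = 0 then
   Lmin = 0, and the last term is 0 since 0^-1 = 0: this is its value under the
   convention that a minimum over the empty set is +oo. *)
Definition C3_sq (R : realType) (delta theta a tau C4 Lmin : R) : R :=
  3 * (Num.sqrt (1 + a) + tau^-1) ^+ 2 * ((C0' delta theta + C4) ^+ 2 + 1)
  + 4 * (1 + a) / Lmin ^+ 2.

Definition mutually_independent (R : realType) (d : measure_display)
    (T : measurableType d) (P : probability T R) (n : nat)
    (Z : 'I_n -> {RV P >-> R}) : Prop :=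
  forall (J : {set 'I_n}) (A : 'I_n -> set R), (forall i, measurable (A i)) ->
    P (\bigcap_(i in [set` J]) (Z i @^-1` A i))
    = (\prod_(i in J) P (Z i @^-1` A i))%E.

(* N(0, sigma^2 I_n); the second parameter of normal_prob is the standard
   deviation. *)
Definition isotropic_gaussian (R : realType) (d : measure_display)
    (T : measurableType d) (P : probability T R) (n : nat)
    (eps : 'I_n -> {RV P >-> R}) (sigma : R) : Prop :=
  (forall i (A : set R), measurable A ->
     distribution P (eps i) A = normal_prob 0 sigma A)
  /\ mutually_independent eps.

Definition response (R : realType) (d : measure_display)
    (T : measurableType d) (P : probability T R) (n p : nat)
    (X : 'M[R]_(n, p)) (beta : 'cV[R]_p) (eps : 'I_n -> {RV P >-> R})
    (w : T) : 'cV[R]_n :=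
  X *m beta + \col_i eps i w.

Definition thresholded_set (R : realType) (p : nat) (b : 'cV[R]_p) (t0 : R) :
    {set 'I_p} :=
  [set j | t0 <= `|b j 0|]%SET.

(* The Dantzig selector need not be unique, so an estimator built from an
   arbitrary choice of minimizer need not be measurable; "E has probability at
   least q" is read as: E contains a measurable event of probability at least q.
   For measurable E this is q <= P E. *)
Definition prob_at_least (R : realType) (d : measure_display)
    (T : measurableType d) (P : probability T R) (E : set T) (q : R) : Prop :=
  exists A : set T, [/\ measurable A, A `<=` E & (q%:E <= P A)%E].

(* Main.v *)
Require Import Defs.
From HB Require Import structures.
From mathcomp Require Import all_boot all_order all_algebra.
From mathcomp Require Import all_classical all_reals all_analysis.
From mathcomp Require Import measurable_realfun.
From mathcomp Require Import ring lra.

Set Implicit Arguments.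
Unset Strict Implicit.
Unset Printing Implicit Defensive.

Import Order.TTheory GRing.Theory Num.Theory.
Import numFieldNormedType.Exports.

Local Open Scope classical_set_scope.
Local Open Scope ring_scope.

(** On the event that every normalised correlation |<X_j, eps>|/n is at most
    sqrt(1+a) times the universal level, the argument is deterministic.  Let T0
    be the s0 largest coordinates of beta.  A (nearly optimal) Lasso fit b' of
    the image of the remaining coordinates has small l1 norm, and beta_T0 + b'
    is feasible for the Dantzig program, so h = beta_init - beta_T0 lies in a
    cone up to an additive error.  Peeling off the coordinates of h in blocks of
    size s0 and using the restricted isometry and orthogonality constants, one
    bounds the l2 norm of h on T0 and on the next s0 coordinates.  Hence at most
    s0 coordinates outside T0 exceed the threshold and the coordinates of beta
    that are missed are small; the normal equations then control the least
    squares error.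

    For the probability of the event, completing the square shows that a linear
    combination of independent centred normal variables is normal, and the Mills
    ratio and a union bound over the p columns conclude. *)

(** * Normal laws *)

Section normal_law.
Variable R : realType.
Local Notation mu := (@lebesgue_measure R).

(** The bounds must scale with [s0], not with [s]. The part of [beta] outside T0 has l2 norm at most
    sqrt(s0) times [l0], the universal level times sigma, but its l1 norm may be of order sqrt(s s0)
    times [l0]; comparing [beta_init] with [beta] itself would give a cone condition with too large
    an error. Feasibility sees this part only through its image under X, so it may be replaced by a
    vector with nearly the same correlations and a smaller l1 norm: an approximate Lasso fit at
    level [l0 / tau] changes the correlations by at most [l0 / tau] and has l1 norm at most (1 +
    delta) tau s0 [l0]. The term tau^-1 in [dantzig_level] is exactly the room this replacement
    uses, while sqrt(1 + a) covers the noise. *)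

Lemma probability_eq_rays (P Q : probability (measurableTypeR R) R) :
  (forall x : R, P `[x, +oo[%classic = Q `[x, +oo[%classic) ->
  forall A, measurable A -> P A = Q A.
Proof.
move=> PQ A mA.
(* Closed right rays are stable under intersection, generate the Borel sets and exhaust the line, so
   they determine a finite measure. *)
apply: (@measure_unique _ R (measurableTypeR R) (@RGenCInfty.G R) (fun n =>
  `[- n%:R, +oo[%classic)) => //.
- exact: RGenCInfty.measurableE.
- move=> _ _ [x ->] [y ->]; exists (Num.max x y).
  apply/seteqP; split => z /=; rewrite !in_itv/= !andbT ge_max.
    by move=> [-> ->].
  by move=> /andP[].
- by move=> i; eexists.
- apply/seteqP; split => // x _.
  exists (Num.truncn `|x|).+1 => //=; rewrite in_itv/= andbT lerNl.
  by rewrite (le_trans _ (ltW (truncnS_gt _)))// -normrN ler_norm.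
- by move=> _ [x ->]; exact: PQ.
- by move=> k; rewrite (le_lt_trans (probability_le1 _ _))// ltry.
Qed.

Lemma eq_distribution_rays d1 d2 (T1 : measurableType d1)
    (T2 : measurableType d2) (P : probability T1 R) (Q : probability T2 R)
    (f : T1 -> measurableTypeR R) (g : T2 -> measurableTypeR R) :
  measurable_fun setT f -> measurable_fun setT g ->
  (forall x : R, P (f @^-1` `[x, +oo[%classic) =
    Q (g @^-1` `[x, +oo[%classic)) ->
  forall A, measurable A -> P (f @^-1` A) = Q (g @^-1` A).
Proof.
move=> mf mg fg A mA.
pose f' : {mfun T1 >-> measurableTypeR R} :=
  HB.pack f (isMeasurableFun.Build _ _ _ _ f mf).
pose g' : {mfun T2 >-> measurableTypeR R} :=
  HB.pack g (isMeasurableFun.Build _ _ _ _ g mg).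
exact: (@probability_eq_rays (distribution P f') (distribution Q g') fg).
Qed.

(** The density is a version of the Radon-Nikodym derivative, since both have the same integral over
    every measurable set. *)
Lemma integral_normal_prob (m s : R) (f : R -> \bar R) :
  (normal_prob m s).-integrable setT f ->
  (\int[normal_prob m s]_x f x = \int[mu]_x (f x * (normal_pdf m s x)%:E))%E.
Proof.
move=> intf.
have dom := @normal_prob_dominates R m s.
have mf := measurable_int _ intf.
have intRN := @Radon_Nikodym_integrable _ _ R
  (charge_of_finite_measure (normal_prob m s)) lebesgue_measure dom.
have mpdf : measurable_fun setT (fun x => (normal_pdf m s x)%:E).
  by apply/measurable_EFinP; exact: measurable_normal_pdf.
rewrite -(Radon_Nikodym_change_of_variables dom)//=.
have RNae : ae_eq lebesgue_measure setT
    (Radon_Nikodym (charge_of_finite_measure (normal_prob m s))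
      lebesgue_measure)
    (fun x => (normal_pdf m s x)%:E).
  apply: integral_ae_eq => //.
  by move=> E _ mE; rewrite -Radon_Nikodym_integral.
apply: ae_eq_integral => //.
- by apply: emeasurable_funM => //; exact: (measurable_int _ intRN).
- by apply: emeasurable_funM.
- exact: ae_eqe_mul2l.
Qed.

(** The joint density of a standard normal x and z = c x + s y, factored in two ways: law of x times
    law of z given x, and law of z times law of x given z. *)
Lemma normal_pdf_mul (c s x z : R) : s != 0 ->
  let r := Num.sqrt (c ^+ 2 + s ^+ 2) in
  normal_pdf 0 1 x * normal_pdf (c * x) s z =
  normal_pdf 0 r z * normal_pdf (c * z / r ^+ 2) (s / r) x.
Proof.
move=> s0 r.
have s2 : 0 < s ^+ 2 by rewrite exprn_even_gt0.
have r2 : r ^+ 2 = c ^+ 2 + s ^+ 2 by rewrite sqr_sqrtr// addr_ge0// sqr_ge0.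
have r0 : r != 0.
  by rewrite sqrtr_eq0 -ltNge ltr_wpDl// sqr_ge0.
rewrite !normal_pdfE//; last by rewrite mulf_neq0// invr_neq0.
rewrite mulrACA [RHS]mulrACA -!expRD; congr (_ * expR _).
  rewrite /normal_peak -!invfM -!sqrtrM; last 2 first.
    by rewrite mulrn_wge0// mulr_ge0// ?sqr_ge0// pi_ge0.
    by rewrite mulrn_wge0// mulr_ge0// ?sqr_ge0// pi_ge0.
  congr (Num.sqrt _)^-1; rewrite expr_div_n; field.
  by rewrite r0.
rewrite expr_div_n r2; field.
rewrite -r2; apply/andP; split => //.
by rewrite expf_neq0.
Qed.

Lemma normal_prob_opp (A : set R) : measurable A ->
  normal_prob 0 1 (-%R @^-1` A) = normal_prob 0 1 A.
Proof.
move=> mA.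
have mopp : measurable_fun [set: measurableTypeR R] (-%R : R -> R) by [].
have mid : measurable_fun [set: measurableTypeR R] (id : R -> R) by [].
apply: (@eq_distribution_rays _ _ _ _ (normal_prob 0 1) (normal_prob 0 1)
  (-%R) id mopp mid) mA => x.
have -> : -%R @^-1` `[x, +oo[%classic = `]-oo, - x]%classic :> set R.
  by apply/seteqP; split => y /=; rewrite !in_itv/= ?andbT lerNr.
rewrite /= preimage_id /normal_prob ge0_integration_by_substitutionNy.
- apply: eq_integral => y _ /=.
  by rewrite !normal_pdfE ?oner_eq0// /normal_fun !subr0 sqrrN.
- by apply: continuous_subspaceT; apply: continuous_normal_pdf;
    rewrite oner_eq0.
- by move=> y _; rewrite normal_pdf_ge0.
Qed.

Lemma normal_pdf_affine (a b y : R) : 0 < b ->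
  normal_pdf a b (a + b * y) * b = normal_pdf 0 1 y.
Proof.
move=> b0; have b0' : b != 0 by rewrite gt_eqF.
rewrite !normal_pdfE ?oner_eq0// mulrAC; congr (_ * expR _).
  rewrite /normal_peak -mulrnAr sqrtrM ?sqr_ge0// sqrtr_sqr ger0_norm 1?ltW//.
  by rewrite invfM mulrAC mulVf// expr1n !mul1r.
by field.
Qed.

Lemma normal_prob_affine_pos (a b : R) (A : set R) : 0 < b -> measurable A ->
  normal_prob 0 1 ((fun y => a + b * y) @^-1` A) = normal_prob a b A.
Proof.
move=> b0 mA; have b0' : b != 0 by rewrite gt_eqF.
pose F := fun y : R => a + b * y.
have mF : measurable_fun [set: measurableTypeR R] F.
  by apply: measurable_funD => //; exact: measurable_funM.
have mid : measurable_fun [set: measurableTypeR R] (id : R -> R) by [].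
apply: (@eq_distribution_rays _ _ _ _ (normal_prob 0 1) (normal_prob a b)
  F id mF mid) mA => x.
have -> : F @^-1` `[x, +oo[%classic = `[(x - a) / b, +oo[%classic :> set R.
  apply/seteqP; split => y /=; rewrite !in_itv/= !andbT ler_pdivrMr// mulrC.
    by rewrite lerBlDl.
  by rewrite lerBlDl.
have derF (y : R) : derivable F y (1 : R) by [].
have dF1 : F^`()%classic = cst b.
  apply/funext => z; rewrite derive1E deriveD// deriveM// !derive_cst derive_id.
  by rewrite add0r scaler0 addr0 [LHS]mulr1.
have Fx : F ((x - a) / b) = x by rewrite /F mulrC divfK// subrKC.
rewrite /= preimage_id /normal_prob -[in RHS]Fx.
rewrite (@increasing_ge0_integration_by_substitutiony R F (normal_pdf a b)).
- apply: eq_integral => y _ /=; congr EFin.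
  by rewrite fctE dF1/= normal_pdf_affine.
- by move=> y z _ _ yz; rewrite /F ltrD2l ltr_pM2l.
- by rewrite dF1 => y _; exact: cvg_cst.
- by rewrite dF1; exact: is_cvg_cst.
- by rewrite dF1; exact: is_cvg_cst.
- split; first by move=> y _; exact: derF.
  apply: cvg_at_right_filter; apply: differentiable_continuous.
  by apply/derivable1_diffP; exact: derF.
- rewrite (_ : F = fun y => b * y + a); last by apply/funext => y;
    rewrite addrC.
  apply: (cvg_comp (fun y => b * y) (fun y => y + a)); last exact: cvg_addrr.
  by apply/gt0_cvgMry => //; exact: cvg_id.
- by apply: continuous_subspaceT; exact: continuous_normal_pdf.
- by move=> y _; rewrite normal_pdf_ge0.
Qed.

(** A negative slope is a reflection followed by a positive slope, and the density depends on [b]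
    only through its square. *)
Lemma normal_prob_affine (a b : R) (A : set R) : b != 0 -> measurable A ->
  normal_prob 0 1 ((fun y => a + b * y) @^-1` A) = normal_prob a b A.
Proof.
move=> b0 mA; have [b_gt0|b_le0] := ltP 0 b.
  exact: normal_prob_affine_pos.
have b_lt0 : b < 0 by rewrite lt_neqAle b0.
have mF : measurable_fun [set: measurableTypeR R] (fun y : R => a + (- b) * y).
  by apply: measurable_funD => //; exact: measurable_funM.
have -> : (fun y => a + b * y) @^-1` A =
    -%R @^-1` ((fun y => a + (- b) * y) @^-1` A).
  by apply/seteqP; split => y /=; rewrite mulrNN.
rewrite normal_prob_opp; last by rewrite -[X in measurable X]setTI; exact: mF.
have Nb0 : 0 < - b by rewrite oppr_gt0.
rewrite (normal_prob_affine_pos a Nb0 mA); apply: eq_integral => y _.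
by rewrite !normal_pdfE ?oppr_eq0// /normal_fun /normal_peak sqrrN.
Qed.

Lemma measurable_normal_pdf_scale (c s : R) : s != 0 ->
  measurable_fun [set: measurableTypeR R * measurableTypeR R]
    (fun z => normal_pdf (c * z.1) s z.2).
Proof.
move=> s0; rewrite [X in measurable_fun _ X](_ : _ = fun z =>
    normal_pdf 0 s (z.2 - c * z.1)).
  apply: (measurableT_comp (measurable_normal_pdf 0 s)) => //.
  apply: measurable_funB => //.
  by apply: measurable_funM => //.
by apply/funext => z; rewrite !normal_pdfE// /normal_fun subr0.
Qed.

(* Completing the square leaves, in the integral over x, a normal density of
   total mass one. *)
Lemma normal_prob_convolution (c s : R) (A : set R) : measurable A ->
  (\int[normal_prob 0 1]_x normal_prob 0 1 [set y : R | A (c * x + s * y)%R] =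
   normal_prob 0 1 [set x : R | A (Num.sqrt (c ^+ 2 + s ^+ 2) * x)%R])%E.
Proof.
move=> mA; have [->|s0] := eqVneq s 0.
  (* For [s = 0] the inner probability is the indicator of [A (c * x)], and the scale on the right
     is the absolute value of [c]; symmetry of the law settles the sign. *)
  rewrite expr0n/= addr0 sqrtr_sqr.
  rewrite (_ : (fun x : R => _) = fun x =>
    (\1_[set x | A (c * x)] x)%:E :> \bar R); last first.
    apply/funext => x; rewrite indicE.
    have [Ax|nAx] := pselect (A (c * x)).
      rewrite mem_set// [X in normal_prob _ _ X](_ : _ =
        setT) ?probability_setT//.
      by apply/seteqP; split => // y _ /=; rewrite mul0r addr0.
    rewrite memNset// [X in normal_prob _ _ X](_ : _ = set0) ?measure0//.
    by apply/seteqP; split => // y /=; rewrite mul0r addr0.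
  have mc (k : R) : measurable_fun [set: measurableTypeR R] (fun y : R =>
    k * y).
    exact: measurable_funM.
  have mcA k : measurable [set x : measurableTypeR R | A (k * x)].
    by rewrite -[X in measurable X]setTI; exact: (mc k).
  rewrite integral_indic// setIT.
  have [c0|c0] := ger0P c; first by [].
  have <- : -%R @^-1` [set x : R | A (c * x)] = [set x : R | A (- c * x)].
    by apply/seteqP; split => x /=; rewrite mulrN mulNr.
  by rewrite (normal_prob_opp (mcA c)).
set r := Num.sqrt _.
have r0 : 0 < r by rewrite sqrtr_gt0 ltr_wpDl ?sqr_ge0// exprn_even_gt0.
have -> : (fun x : R => normal_prob 0 1 [set y : R | A (c * x + s * y)]) =
    (fun x : R => normal_prob (c * x) s A).
  by apply/funext => x; rewrite -(normal_prob_affine _ s0 mA).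
have mpdf : measurable_fun [set: measurableTypeR R * measurableTypeR R]
    (fun z => (\1_A z.2 * normal_pdf (c * z.1) s z.2)%:E).
  apply/measurable_EFinP; apply: measurable_funM => //.
    exact: measurableT_comp.
  exact: measurable_normal_pdf_scale.
have mprod : measurable_fun [set: measurableTypeR R * measurableTypeR R]
    (fun z => (normal_pdf 0 1 z.1 * (\1_A z.2 * normal_pdf (c * z.1) s
      z.2))%:E).
  apply/measurable_EFinP; apply: measurable_funM => //.
    by apply: measurableT_comp => //; exact: measurable_normal_pdf.
  exact/measurable_EFinP.
have pE x : normal_prob (c * x) s A =
    (\int[mu]_z (\1_A z * normal_pdf (c * x) s z)%:E)%E.
  rewrite /normal_prob integral_mkcond; apply: eq_integral => z _.
  by rewrite patchE indicE; case: ifP => _; rewrite ?mul1r ?mul0r.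
have mp : measurable_fun [set: measurableTypeR R] (fun x : R =>
  normal_prob (c * x) s A).
  rewrite (_ : (fun x : R => _) = fun x =>
    \int[mu]_z (\1_A z * normal_pdf (c * x) s z)%:E)%E; last first.
    by apply/funext => x; exact: pE.
  apply: (@measurable_fun_fubini_tonelli_F _ _ _ _ R mu _ mpdf) => z.
  by rewrite lee_fin mulr_ge0// normal_pdf_ge0.
rewrite integral_normal_prob; last first.
  apply/integrableP; split => //.
  apply: (@le_lt_trans _ _ (\int[normal_prob 0 1]_(x in [set: R]) (cst 1 x))%E).
    have mabs : measurable_fun [set: measurableTypeR R]
        (fun x : R => `|normal_prob (c * x) s A|)%E.
      by have := measurableT_comp (@abse_measurable R setT) mp.
    apply: ge0_le_integral => //.
    by move=> x _; rewrite gee0_abs// probability_le1.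
  by rewrite integral_cst//= mul1e -ge0_fin_numE// fin_num_measure.
transitivity (\int[mu]_x \int[mu]_z
    (normal_pdf 0 1 x * (\1_A z * normal_pdf (c * x) s z))%:E)%E.
  apply: eq_integral => x _; rewrite pE muleC.
  rewrite -ge0_integralZl//.
  - exact: (measurable_fun_pair2 x mpdf).
  - by move=> z _; rewrite lee_fin mulr_ge0// normal_pdf_ge0.
  - by rewrite lee_fin normal_pdf_ge0.
rewrite (@fubini_tonelli _ _ _ _ _ mu mu _ mprod) /=; last first.
  by move=> z; rewrite lee_fin !mulr_ge0// normal_pdf_ge0.
transitivity (\int[mu]_(z in A) (normal_pdf 0 r z)%:E)%E; last first.
  rewrite -[LHS]/(normal_prob 0 r A) -normal_prob_affine ?gt_eqF//.
  have <- : (fun y => 0 + r * y) @^-1` A = [set x : R | A (r * x)].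
    by apply/seteqP; split => x /=; rewrite add0r.
  by [].
rewrite [RHS]integral_mkcond; apply: eq_integral => z _.
transitivity (\int[mu]_x ((\1_A z * normal_pdf 0 r z)%:E *
    (normal_pdf (c * z / r ^+ 2) (s / r) x)%:E))%E.
  apply: eq_integral => x _; rewrite -EFinM mulrCA normal_pdf_mul//.
  by rewrite mulrA.
rewrite ge0_integralZl//.
- rewrite integral_normal_pdf mule1 patchE indicE.
  by case: ifP => _; rewrite ?mul1r ?mul0r.
- by apply/measurable_EFinP; exact: measurable_normal_pdf.
- by move=> x _; rewrite lee_fin normal_pdf_ge0.
- by rewrite lee_fin mulr_ge0// normal_pdf_ge0.
Qed.

(** A measure that factors on rectangles is a product measure, and the convolution formula then
    applies to it. The mass [K] is there because [m] will be the law of a pair restricted to an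
    event about further independent variables. *)
Lemma scaled_normal_product
    (m : {measure set (measurableTypeR R * measurableTypeR R) -> \bar R})
    (r q c K : R) (A : set R) :
  0 <= K -> measurable A ->
  (forall A B : set R, measurable A -> measurable B ->
     m (A `*` B) = normal_prob 0 1 [set x | A (r * x)%R] *
                   (K%:E * normal_prob 0 1 [set x | B (q * x)%R]))%E ->
  (m [set z | A (z.1 + c * z.2)%R] =
   normal_prob 0 1 [set x | A (Num.sqrt (r ^+ 2 + (c * q) ^+ 2) * x)%R] *
   K%:E)%E.
Proof.
move=> K0 mA mE.
pose sc (k : R) : measurableTypeR R -> measurableTypeR R := fun y : R => k * y.
have mc (k : R) : measurable_fun setT (sc k) by exact: measurable_funM.
pose fr : {mfun measurableTypeR R >-> measurableTypeR R} :=
  HB.pack (sc r) (isMeasurableFun.Build _ _ _ _ _ (mc r)).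
pose fq : {mfun measurableTypeR R >-> measurableTypeR R} :=
  HB.pack (sc q) (isMeasurableFun.Build _ _ _ _ _ (mc q)).
pose m1 := distribution (normal_prob 0 1) fr.
pose m2 := mscale (NngNum K0) (distribution (normal_prob 0 1) fq).
set E := [set z | _].
have mEs : measurable (E : set (measurableTypeR R * measurableTypeR R)).
  rewrite -[E]setTI; apply: (_ : measurable_fun setT (fun z :
    measurableTypeR R * measurableTypeR R => z.1 + c * z.2)) => //.
  by apply: measurable_funD => //; exact: measurable_funM.
rewrite -(@product_measure_unique _ _ _ _ R m1 m2 m) //.
rewrite /product_measure1.
have ms : measurable_fun [set: measurableTypeR R]
    (fun x => distribution (normal_prob 0 1) fq (xsection E x)).
  exact: measurable_fun_xsection.
rewrite ge0_integral_pushforward//=; last first.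
  exact: (measurable_fun_xsection m2).
rewrite preimage_setT -(normal_prob_convolution r (c * q) mA) muleC
  -ge0_integralZl//=.
- apply: eq_integral => x _; congr (_ * normal_prob 0 1 _)%E.
  by apply/seteqP; split => y; rewrite /xsection/= in_setE /E/= /sc mulrA.
- have -> : (fun x : R => normal_prob 0 1 [set y : R | A (r * x +
    c * q * y)%R]) =
      (fun x : R => distribution (normal_prob 0 1) fq (xsection E x)) \o sc r.
    apply/funext => x /=; congr (normal_prob 0 1 _)%E.
    by apply/seteqP; split => y; rewrite /xsection/= in_setE /E/= /sc mulrA.
  exact: (measurableT_comp ms (mc r)).
Qed.

(** Mutual independence speaks only of product events, so the induction on [k] must carry arbitrary
    events [B i] on the coordinates not yet summed: absorbing coordinate [k] into the sum requires
    its joint law with the partial sum, on the event about all later coordinates. *)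
Lemma independent_normal_sum (d : measure_display) (T : measurableType d)
    (P : probability T R) (n : nat) (eps : 'I_n -> {RV P >-> R}) (sigma : R)
    (c : 'I_n -> R) (k : nat) (A : set R) (B : 'I_n -> set R) :
  0 < sigma -> isotropic_gaussian eps sigma ->
  measurable A -> (forall i, measurable (B i)) -> (k <= n)%N ->
  P ([set w | A (\sum_(i < n | (i < k)%N) c i * eps i w)] `&`
     \bigcap_(i in [set` [set i : 'I_n | (k <= i)%N]%SET]) (eps i @^-1` B i)) =
  (normal_prob 0 1 [set x | A (sigma *
     Num.sqrt (\sum_(i < n | (i < k)%N) c i ^+ 2) * x)%R] *
   \prod_(i in [set i : 'I_n | (k <= i)%N]%SET) P (eps i @^-1` B i))%E.
Proof.
move=> s0 [law ind] + + ; elim: k A B => [|k IH] A B mA mB kn.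
  (* With an empty sum the scale is zero, and both sets are full or empty according to [A 0]. *)
  rewrite (_ : [set w | A _] = [set w | A 0]); last first.
    by apply/seteqP; split => w /=; rewrite big_pred0.
  rewrite (_ : [set x : R | A _] = [set x | A 0]); last first.
    by apply/seteqP; split => w /=; rewrite big_pred0// sqrtr0 mulr0 mul0r.
  have [A0|A0] := pselect (A 0).
    rewrite (_ : [set _ | A 0] = setT); last by apply/seteqP; split.
    rewrite (_ : [set _ | A 0] = setT); last by apply/seteqP; split.
    by rewrite setTI ind// [X in (X * _)%E]probability_setT mul1e.
  rewrite (_ : [set _ | A 0] = set0); last by apply/seteqP; split.
  rewrite (_ : [set _ | A 0] = set0); last by apply/seteqP; split.
  by rewrite set0I !measure0 mul0e.
pose i0 := Ordinal kn.
pose S w := \sum_(i < n | (i < k)%N) c i * eps i w.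
pose W :=
  \bigcap_(i in [set` [set i : 'I_n | (k < i)%N]%SET]) (eps i @^-1` B i).
have mpre i C : measurable C -> measurable (eps i @^-1` C).
  by move=> mC; rewrite -[X in measurable X]setTI; exact: measurable_funPT.
have mW : measurable W.
  by apply: fin_bigcap_measurable => // i _; exact: mpre.
have mS : measurable_fun setT S.
  rewrite (_ : S = fun w =>
      \sum_(i < n) (if (i < k)%N then c i else 0) * eps i w).
    by apply: measurable_sum => i; exact: measurable_funM.
  apply/funext => w; rewrite /S big_mkcond; apply: eq_bigr => i _.
  by case: ifP; rewrite ?mul0r.
have mS' : @measurable_fun _ _ T (measurableTypeR R) setT S.
  by move=> mT C mC; exact: mS.
have meps' : @measurable_fun _ _ T (measurableTypeR R) setT (eps i0).
  by move=> mT C mC; exact: (measurable_funPT (eps i0)).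
have mpair : measurable_fun [set: T] (fun w => (S w, eps i0 w) :
  measurableTypeR R * measurableTypeR R).
  by apply: measurable_fun_pair.
pose pr : {mfun T >-> (measurableTypeR R * measurableTypeR R)%type} :=
  HB.pack (fun w => (S w, eps i0 w) : measurableTypeR R * measurableTypeR R)
    (isMeasurableFun.Build _ _ _ _ _ mpair).
(* The law of the partial sum and the next variable, restricted to the event [W] on later
   coordinates. The induction hypothesis with [D] in place of [B i0] evaluates it on rectangles. *)
pose m := pushforward (mrestr P mW) pr.
pose K :=
  fine (\prod_(i in [set i : 'I_n | (k < i)%N]%SET) P (eps i @^-1` B i))%E.
have Kfin : (\prod_(i in [set i : 'I_n | (k < i)%N]%SET) P (eps i @^-1` B i))%E
  \is a fin_num.
  by rewrite -ind//; exact: (fin_num_measure P _ mW).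
have KE : K%:E =
    (\prod_(i in [set i : 'I_n | (k < i)%N]%SET) P (eps i @^-1` B i))%E.
  by rewrite /K fineK.
have K0 : 0 <= K by rewrite fine_ge0// -ind.
have sumE (F : 'I_n -> R) : \sum_(i < n | (i < k.+1)%N) F i =
    \sum_(i < n | (i < k)%N) F i + F i0.
  rewrite (bigD1 i0)//= addrC; congr (_ + _); apply: eq_bigl => i.
  by rewrite ltnS -val_eqE/= andbC ltn_neqAle.
have rectE C D : measurable C -> measurable D ->
  (m (C `*` D) = normal_prob 0 1 [set x | C (sigma *
       Num.sqrt (\sum_(i < n | (i < k)%N) c i ^+ 2) * x)%R] *
       (K%:E * normal_prob 0 1 [set x | D (sigma * x)%R]))%E.
  move=> mC mD.
  have memE i :
      (i \in [set i : 'I_n | (k <= i)%N]%SET) = (i == i0) || (k < i)%N.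
    by rewrite inE -val_eqE/= leq_eqVlt eq_sym.
  have prodE : (\prod_(i in [set i : 'I_n | (k <= i)%N]%SET)
      P (eps i @^-1` (if i == i0 then D else B i)) =
        P (eps i0 @^-1` D) * K%:E)%E.
    rewrite (bigD1 i0)/=; last by rewrite memE eqxx.
    rewrite eqxx KE; congr (_ * _)%E; apply: eq_big =>
      [i|i /andP[_ /negbTE ->]//].
    rewrite memE finset.in_set -val_eqE/=.
    by case: (ltngtP k i) => // ki; rewrite ?andbF ?andbT//= -?ki ?eqxx.
  have law0 : P (eps i0 @^-1` D) = normal_prob 0 1 [set x | D (sigma * x)%R].
    have <- : (fun y => 0 + sigma * y) @^-1` D = [set x | D (sigma * x)%R].
      by apply/seteqP; split => x /=; rewrite add0r.
    by rewrite (normal_prob_affine 0 (lt0r_neq0 s0) mD); exact: law.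
  have mB' i : measurable (if i == i0 then D else B i).
    by case: ifP => _; [exact: mD|exact: mB].
  have := IH C (fun i => if i == i0 then D else B i) mC mB' (ltnW kn).
  rewrite prodE law0 (muleC _ K%:E) => <-.
  rewrite /m /pushforward /mrestr; congr (P _).
  apply/seteqP; split => w /=.
    move=> [[Cw Dw] Ww]; split => // i /=; rewrite memE.
    have [->//|_/= ki] := eqVneq i i0.
    by apply: Ww; rewrite /= inE.
  move=> [Cw Dw]; split; first split => //.
    by have := Dw i0; rewrite /= eqxx; apply; rewrite memE eqxx.
  move=> i /=; rewrite inE => ki; have := Dw i;
    rewrite /= memE ki orbT => /(_ isT).
  by rewrite -val_eqE/= gtn_eqF.
have := scaled_normal_product (c i0) K0 mA rectE.
rewrite -KE !exprMn sqr_sqrtr; last by apply: sumr_ge0 => i _; rewrite sqr_ge0.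
rewrite (mulrC (c i0 ^+ 2)) -mulrDr -sumE sqrtrM ?sqr_ge0// sqrtr_sqr
  gtr0_norm//.
move=> <-; rewrite /m /pushforward /mrestr; congr (P (_ `&` _)).
by apply/seteqP; split => w /=; rewrite sumE.
Qed.

Lemma normal_sum_law (d : measure_display) (T : measurableType d)
    (P : probability T R) (n : nat) (eps : 'I_n -> {RV P >-> R}) (sigma : R)
    (c : 'I_n -> R) (A : set R) :
  0 < sigma -> isotropic_gaussian eps sigma -> measurable A ->
  P [set w | A (\sum_(i < n) c i * eps i w)] =
  normal_prob 0 1 [set x | A (sigma * Num.sqrt (\sum_(i < n) c i ^+ 2) * x)%R].
Proof.
move=> s0 Heps mA.
have := @independent_normal_sum _ _ _ _ _ _ c n A (fun=> setT) s0 Heps mA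
  (fun=> measurableT) (leqnn n).
rewrite [X in (_ * X)%E]big_pred0 ?mule1; last first.
  by move=> i; rewrite finset.in_set leqNgt ltn_ord.
have sE (F : 'I_n -> R) : \sum_(i < n | (i < n)%N) F i = \sum_(i < n) F i.
  by apply: eq_bigl => i; rewrite ltn_ord.
rewrite sE.
move=> <-; congr (P _); apply/seteqP; split => w /=.
  by move=> Aw; split => //; rewrite sE.
by move=> [Aw _]; rewrite sE in Aw.
Qed.

(** * Gaussian tails and the Mills ratio *)

Lemma normal_pdf01E : normal_pdf 0 1 =
  (fun x : R => normal_peak 1 * gauss_fun (x * (Num.sqrt 2)^-1)).
Proof.
apply/funext => x; rewrite normal_pdfE ?oner_eq0// /normal_fun /gauss_fun.
by rewrite subr0 expr1n exprMn exprVn sqr_sqrtr// mulNr.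
Qed.

Lemma cvg_normal_pdf01 : normal_pdf (0:R) 1 x @[x --> +oo] --> (0 : R).
Proof.
rewrite normal_pdf01E -[X in _ --> X](mulr0 (normal_peak (1:R))); apply: cvgMr.
apply: (cvg_comp (fun x : R => x * (Num.sqrt 2)^-1) (@gauss_fun R)).
  by apply/gt0_cvgMly; rewrite ?invr_gt0 ?sqrtr_gt0//; exact: cvg_id.
exact: cvg_gauss_fun.
Qed.

Lemma is_derive_normal_pdf01 (x : R) :
  is_derive x (1:R) (normal_pdf 0 1) (- (x * normal_pdf 0 1 x)).
Proof.
have -> : normal_pdf 0 1 =
    normal_peak 1 \*: (expR \o (- 2^-1 \*: (id ^+ 2 : R -> R))) :> (R -> R).
  apply/funext => y; rewrite normal_pdfE ?oner_eq0// /normal_fun/=.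
  by congr (_ * expR _); rewrite subr0 expr1n /GRing.scale/= !fctE; field.
apply: is_derive_eq.
rewrite /= /GRing.scale/= !fctE /=.
rewrite expr1 !mulr1; by field.
Qed.

(** On the ray, the density at x is at most x / t times itself, and x times the density is the
    derivative of minus the density, so the larger integrand has an explicit integral. *)
Lemma normal_tail_le (t : R) : 0 < t ->
  (normal_prob 0 1 `[t, +oo[%classic <= (normal_pdf 0 1 t / t)%:E)%E.
Proof.
move=> t0.
have mf : measurable_fun [set: R] (fun x : R => t^-1 * (x * normal_pdf 0 1 x)).
  by do 2 apply: measurable_funM => //; exact: measurable_normal_pdf.
pose F : R -> R := - (t^-1 \*: normal_pdf 0 1).
have dF (x : R) : is_derive x (1 : R) F (t^-1 * (x * normal_pdf 0 1 x)).
  have dpdf := is_derive_normal_pdf01 x.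
  by apply: is_derive_eq; rewrite scalerN opprK.
have -> : (normal_pdf 0 1 t / t)%:E =
    (\int[mu]_(x in `[t, +oo[) (t^-1 * (x * normal_pdf 0 1 x))%:E)%E.
  rewrite (@ge0_continuous_FTC2y R _ F t 0).
  - by rewrite add0e -EFinN opprK mulrC.
  - move=> x tx; rewrite !mulr_ge0 ?invr_ge0 ?normal_pdf_ge0// ?ltW//.
    exact: lt_le_trans tx.
  - apply: continuous_subspaceT => x; apply: cvgMr; apply: cvgM => //.
    by apply: continuous_normal_pdf; rewrite oner_eq0.
  - rewrite -[X in _ --> X]oppr0 -[X in _ --> - X](mulr0 t^-1); apply: cvgN;
      apply: cvgMr.
    exact: cvg_normal_pdf01.
  - by move=> x _; have [] := dF x.
  - apply: cvg_at_right_filter; apply: cvgN; apply: cvgMr.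
    by apply: continuous_normal_pdf; rewrite oner_eq0.
  - by move=> x _; rewrite derive1E; have [_ ->] := dF x.
apply: ge0_le_integral => //=.
- by move=> x _; rewrite lee_fin normal_pdf_ge0.
- by apply/measurable_funTS/measurable_EFinP; exact: measurable_normal_pdf.
- by apply/measurable_funTS/measurable_EFinP.
- move=> x; rewrite in_itv/= andbT => tx; rewrite lee_fin mulrA.
  by rewrite ler_peMl ?normal_pdf_ge0// mulrC ler_pdivlMr// mul1r.
Qed.

Lemma normal_abs_tail_le (t : R) : 0 < t ->
  (normal_prob 0 1 [set x : R | t < `|x|]%R <=
    (2 * (normal_pdf 0 1 t / t))%:E)%E.
Proof.
move=> t0; have tl := normal_tail_le t0.
have mI : measurable `[t, +oo[%classic by [].
apply: (@le_trans _ _ (normal_prob 0 1 (`[t, +oo[%classic `|` -%R @^-1` `[t,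
  +oo[%classic))).
  apply: le_measure; rewrite ?inE.
  - rewrite (_ : [set _ | _] = (fun x : R => `|x|) @^-1` `]t, +oo[%classic).
      by rewrite -[X in measurable X]setTI; exact: normr_measurable.
    by apply/seteqP; split => x /=; rewrite in_itv/= andbT.
  - apply: measurableU => //.
    by rewrite -[X in measurable X]setTI; exact: oppr_measurable.
  - move=> x /=; rewrite !in_itv/= !andbT ltr_normr => /orP[|] /ltW;
      [by left|by right].
apply: (le_trans (measureU2 _ _ _)) => //.
  by rewrite -[X in measurable X]setTI; exact: oppr_measurable.
by rewrite [X in (_ + X <= _)%E](normal_prob_opp mI) mulr2n mulrDl mul1r EFinD
  leeD.
Qed.

End normal_law.

(** * Sparse vectors and restricted eigenvalues *)

Section finite_sums.
Variables (R : realType) (I : finType).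
Implicit Types (A B D : {set I}) (a b h : I -> R).

Lemma Cauchy_Schwarz_sqr (P : pred I) a b :
  (\sum_(i | P i) a i * b i) ^+ 2 <=
  (\sum_(i | P i) a i ^+ 2) * \sum_(i | P i) b i ^+ 2.
Proof.
set x := \sum_(i | P i) a i * b i.
set u := \sum_(i | P i) a i ^+ 2; set v := \sum_(i | P i) b i ^+ 2.
have v0 : 0 <= v by apply: sumr_ge0 => i _; exact: sqr_ge0.
(* [v * a i - x * b i] is [v] times the residual of projecting [a] on [b]; the factor [v] avoids a
   division by a possibly zero norm. *)
have : 0 <= \sum_(i | P i) (v * a i - x * b i) ^+ 2.
  by apply: sumr_ge0 => i _; exact: sqr_ge0.
have -> : \sum_(i | P i) (v * a i - x * b i) ^+ 2 = v * (u * v - x ^+ 2).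
  transitivity (\sum_(i | P i) v ^+ 2 * a i ^+ 2 -
      \sum_(i | P i) 2 * x * v * (a i * b i) + \sum_(i | P i) x ^+ 2 * b i ^+
        2).
    by rewrite -sumrB -big_split/=; apply: eq_bigr => i _; ring.
  by rewrite -!mulr_sumr -/x -/u -/v; ring.
have [v_gt0|v_le0] := ltP 0 v; first by rewrite pmulr_rge0// subr_ge0.
have v00 : v = 0 by apply/eqP; rewrite eq_le v0 v_le0.
have b0 i : P i -> b i = 0.
  move=> Pi; apply/eqP; rewrite -sqrf_eq0; apply/eqP.
  by move: i Pi; apply: psumr_eq0P v00 => i _; exact: sqr_ge0.
by rewrite v00 mulr0 /x big1 ?expr0n// => i Pi; rewrite b0// mulr0.
Qed.

Lemma Cauchy_Schwarz_sum (P : pred I) a b :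
  `|\sum_(i | P i) a i * b i| <=
  Num.sqrt (\sum_(i | P i) a i ^+ 2) * Num.sqrt (\sum_(i | P i) b i ^+ 2).
Proof.
rewrite -sqrtr_sqr -sqrtrM ?sumr_ge0// => [|i _]; last exact: sqr_ge0.
by rewrite ler_sqrt ?Cauchy_Schwarz_sqr// mulr_ge0// sumr_ge0// => i _;
  exact: sqr_ge0.
Qed.

Lemma l1_le_l2 A h :
  \sum_(i in A) `|h i| <= Num.sqrt #|A|%:R * Num.sqrt (\sum_(i in A) h i ^+ 2).
Proof.
have e1 : \sum_(i in A) (1 : R) ^+ 2 = #|A|%:R.
  by rewrite -sumr_const; apply: eq_bigr => i _; rewrite expr1n.
have e2 : \sum_(i in A) `|h i| ^+ 2 = \sum_(i in A) h i ^+ 2.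
  by apply: eq_bigr => i _; rewrite real_normK// num_real.
have e3 : \sum_(i in A) 1 * `|h i| = \sum_(i in A) `|h i|.
  by apply: eq_bigr => i _; rewrite mul1r.
have := Cauchy_Schwarz_sum (mem A) (fun=> 1) (fun i => `|h i|).
by rewrite e1 e2 e3; apply: le_trans; exact: ler_norm.
Qed.

Lemma exists_largest A (f : I -> R) k : (k <= #|A|)%N ->
  exists B, [/\ B \subset A, #|B| = k &
    forall i j, i \in B -> j \in A :\: B -> f j <= f i].
Proof.
elim: k => [_|k IH kA].
  exists finset.set0; split; [exact: finset.sub0set|exact: cards0|].
  by move=> i j; rewrite finset.in_set0.
have [B [BA Bk Bf]] := IH (ltnW kA).
have /card_gt0P [i0 i0D] : (0 < #|A :\: B|)%N.
  by rewrite cardsD (finset.setIidPr BA) Bk subn_gt0.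
have [i iD imax] := @arg_maxP _ _ _ i0 (mem (A :\: B)) f i0D.
have /finset.setDP[iA iB] : i \in A :\: B by [].
exists (i |: B)%SET; split.
- by rewrite finset.subUset finset.sub1set iA BA.
- by rewrite cardsU1 iB Bk.
- move=> x y; rewrite !inE negb_or => /orP[/eqP ->|xB] /andP[/andP[yi yB] yA].
    by apply: imax; apply/finset.setDP.
  by apply: Bf => //; rewrite !inE yB yA.
Qed.

(* Peel off the m largest entries: those that remain are at most the average of
   the peeled ones. *)
Lemma shelling D h (phi : {set I} -> R) (K : R) (m : nat) :
  0 <= K -> (0 < m)%N ->
  (forall A B, A \subset D -> B \subset A -> phi A <= phi B + phi (A :\: B)) ->
  (forall A, A \subset D -> (#|A| <= m)%N ->
     phi A <= K * Num.sqrt (\sum_(i in A) h i ^+ 2)) ->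
  forall A M, A \subset D -> 0 <= M -> (forall i, i \in A -> `|h i| <= M) ->
  phi A <= K * (Num.sqrt m%:R * M + (\sum_(i in A) `|h i|) / Num.sqrt m%:R).
Proof.
move=> K0 m0 phiD phiK A.
have sm0 : 0 < Num.sqrt m%:R :> R by rewrite sqrtr_gt0 ltr0n.
have sq_le B M : (#|B| <= m)%N -> 0 <= M ->
    (forall i, i \in B -> `|h i| <= M) ->
    Num.sqrt (\sum_(i in B) h i ^+ 2) <= Num.sqrt m%:R * M.
  move=> Bm M0 BM; rewrite -(ger0_norm M0) -sqrtr_sqr -sqrtrM//.
  rewrite ler_sqrt; last by rewrite mulr_ge0// sqr_ge0.
  apply: (@le_trans _ _ (\sum_(i in B) M ^+ 2)).
    apply: ler_sum => i iB; rewrite -(real_normK (num_real (h i))).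
    by rewrite lerXn2r ?nnegrE// BM.
  by rewrite sumr_const -[M ^+ 2 *+ _]mulr_natl ler_wpM2r ?sqr_ge0// ler_nat.
have [k] := ubnP #|A|; elim: k A => // k IH A Ak M AD M0 AM.
have [Am|mA] := leqP #|A| m.
  apply: (le_trans (phiK _ AD Am)); rewrite ler_wpM2l//.
  rewrite (le_trans (sq_le _ _ Am M0 AM))// lerDl divr_ge0 ?sumr_ge0//.
have [B [BA Bm Bh]] := exists_largest (fun i => `|h i|) (ltnW mA).
apply: (le_trans (phiD _ _ AD BA)).
pose M' := (\sum_(i in B) `|h i|) / m%:R.
have M'0 : 0 <= M' by rewrite divr_ge0 ?sumr_ge0.
have AB : A :\: B \subset D by rewrite (fintype.subset_trans _ AD)//
  finset.subsetDl.
have ABk : (#|A :\: B| < k)%N.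
  rewrite cardsD (finset.setIidPr BA) Bm -ltnS (leq_trans _ Ak)// ltnS
    ltn_subrL m0.
  exact: leq_ltn_trans mA.
have hAB i : i \in A :\: B -> `|h i| <= M'.
  move=> iAB; rewrite /M' ler_pdivlMr ?ltr0n// mulr_natr -Bm -sumr_const.
  by apply: ler_sum => j jB; exact: Bh.
have := IH _ ABk M' AB M'0 hAB.
have := phiK _ (fintype.subset_trans BA AD) (eq_leq Bm).
have := sq_le _ _ (eq_leq Bm) M0 (fun i iB => AM i (fintype.subsetP BA i iB)).
move=> /(ler_wpM2l K0) e1 e2 e3.
apply: (le_trans (lerD (le_trans e2 e1) e3)).
rewrite -mulrDr ler_wpM2l// lerD2l.
(* The bound [M'] on the remaining entries costs [Num.sqrt m%:R * M'], which is the l1 mass of [B]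
   over [Num.sqrt m%:R]: each block pays for the next. *)
rewrite [in leRHS](big_setID B)/= (finset.setIidPr BA) mulrDl lerD2r /M'.
set q := Num.sqrt m%:R; have q0 : q != 0 by rewrite gt_eqF.
have <- : q ^+ 2 = m%:R by rewrite sqr_sqrtr.
by rewrite le_eqVlt; apply/orP; left; apply/eqP; field.
Qed.

End finite_sums.

(** * Restriction to coordinate sets and the restricted constants *)

Section design.
Variables (R : realType) (n p : nat) (X : 'M[R]_(n, p)).
Lemma l2norm_ge0 k (v : 'cV[R]_k) : 0 <= l2norm v.
Proof. exact: sqrtr_ge0. Qed.

Lemma l2norm_sqr k (v : 'cV[R]_k) : l2norm v ^+ 2 = \sum_i v i 0 ^+ 2.
Proof. by rewrite sqr_sqrtr// sumr_ge0// => i _; exact: sqr_ge0. Qed.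

Lemma l2norm_eq0 k (v : 'cV[R]_k) : l2norm v = 0 -> v = 0.
Proof.
move=> v0; have := l2norm_sqr v; rewrite v0 expr0n/= => /esym h.
apply/colP => i; rewrite mxE; apply/eqP; rewrite -sqrf_eq0; apply/eqP.
by move: i (isT : true); apply: psumr_eq0P h => i _; exact: sqr_ge0.
Qed.

Lemma dotp_le k (u v : 'cV[R]_k) : `|dotp u v| <= l2norm u * l2norm v.
Proof. exact: Cauchy_Schwarz_sum. Qed.

Lemma dotpDl k (u v w : 'cV[R]_k) : dotp (u + v) w = dotp u w + dotp v w.
Proof. by rewrite -big_split; apply: eq_bigr => i _; rewrite mxE mulrDl. Qed.

Lemma dotpC k (u v : 'cV[R]_k) : dotp u v = dotp v u.
Proof. by apply: eq_bigr => i _; rewrite mulrC. Qed.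

Lemma dotpNl k (u w : 'cV[R]_k) : dotp (- u) w = - dotp u w.
Proof. by rewrite -sumrN; apply: eq_bigr => i _; rewrite mxE mulNr. Qed.

Lemma dotpZl k c (u w : 'cV[R]_k) : dotp (c *: u) w = c * dotp u w.
Proof. by rewrite mulr_sumr; apply: eq_bigr => i _; rewrite mxE mulrA. Qed.

Lemma dotpDr k (u v w : 'cV[R]_k) : dotp w (u + v) = dotp w u + dotp w v.
Proof. by rewrite dotpC dotpDl !(dotpC w). Qed.

Lemma dotpBr k (u v w : 'cV[R]_k) : dotp w (u - v) = dotp w u - dotp w v.
Proof. by rewrite dotpC dotpDl dotpNl !(dotpC w). Qed.

Lemma dotpvv k (u : 'cV[R]_k) : dotp u u = l2norm u ^+ 2.
Proof. by rewrite l2norm_sqr; apply: eq_bigr => i _; rewrite expr2. Qed.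

Lemma dotp_mulmx (u : 'cV[R]_p) (w : 'cV[R]_n) :
  dotp (X *m u) w = \sum_j u j 0 * dotp (col j X) w.
Proof.
transitivity (\sum_i \sum_j u j 0 * (X i j * w i 0)).
  apply: eq_bigr => i _; rewrite mxE mulr_suml.
  by apply: eq_bigr => j _; rewrite mulrA (mulrC (u j 0)).
rewrite exchange_big; apply: eq_bigr => j _; rewrite mulr_sumr.
by apply: eq_bigr => i _; rewrite mxE.
Qed.

(** Restrictions stay in R^p, so those to different sets can be added and compared, which vectors of
    dimension [#|J|] do not allow; [subcols_restr] translates. *)
Definition restr (J : {set 'I_p}) (v : 'cV[R]_p) : 'cV[R]_p :=
  \col_j (if j \in J then v j 0 else 0).

Lemma restr_sum (J : {set 'I_p}) (v : 'cV[R]_p) (F : 'I_p -> R -> R) :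
  (forall j, F j 0 = 0) ->
  \sum_j F j (restr J v j 0) = \sum_(j in J) F j (v j 0).
Proof.
move=> F0; rewrite [RHS]big_mkcond; apply: eq_bigr => j _; rewrite mxE.
by case: ifP.
Qed.

Lemma l2norm_restr (J : {set 'I_p}) (v : 'cV[R]_p) :
  l2norm (restr J v) = Num.sqrt (\sum_(j in J) v j 0 ^+ 2).
Proof. by rewrite /l2norm (@restr_sum J v (fun _ x => x ^+ 2))// expr0n. Qed.

Lemma restrU (A B : {set 'I_p}) (v : 'cV[R]_p) : [disjoint A & B]%B ->
  restr (A :|: B) v = restr A v + restr B v.
Proof.
move=> AB; apply/colP => j; rewrite !mxE inE.
have [jA|jA] := boolP (j \in A); last by rewrite add0r.
by rewrite (disjointFr AB jA) addr0.
Qed.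

Lemma restrT (v : 'cV[R]_p) (J : {set 'I_p}) :
  (forall j, j \notin J -> v j 0 = 0) -> restr J v = v.
Proof. by move=> h; apply/colP => j; rewrite mxE; case: ifPn => // /h ->. Qed.

Lemma subcols_restr (J : {set 'I_p}) (v : 'cV[R]_p) :
  subcols X J *m (\col_k v (enum_val k) 0) = X *m restr J v.
Proof.
apply/colP => i; rewrite !mxE (@restr_sum J v (fun j x => X i j * x)) => [|j];
  last by rewrite mulr0.
rewrite [RHS]big_enum_val; apply: eq_bigr => k _.
by rewrite !mxE.
Qed.

Lemma l2norm_sub_restr (J : {set 'I_p}) (v : 'cV[R]_p) :
  l2norm (\col_(k < #|J|) v (enum_val k) 0) = l2norm (restr J v).
Proof.
rewrite l2norm_restr /l2norm [in RHS]big_enum_val; congr Num.sqrt.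
by apply: eq_bigr => k _; rewrite mxE.
Qed.

Lemma zero_extend_enum (J : {set 'I_p}) (v : 'cV[R]_#|J|) :
  v = \col_k zero_extend v (enum_val k) 0.
Proof.
apply/colP => k; rewrite !mxE (big_pred1 k)// => l /=.
by rewrite (inj_eq enum_val_inj).
Qed.

Hypothesis hX : forall j : 'I_p, l2norm (col j X) = Num.sqrt n%:R.
Hypothesis n0 : (0 < n)%N.
Let nR : 0 < n%:R :> R. Proof. by rewrite ltr0n. Qed.

Lemma col_sqr j : l2norm (col j X) ^+ 2 = n%:R.
Proof. by rewrite hX sqr_sqrtr. Qed.

(** A crude bound, sufficient to show that [p%:R] belongs to the sets whose infima define the
    restricted constants. *)
Lemma l2norm_mulmx_le (v : 'cV[R]_p) :
  l2norm (X *m v) ^+ 2 / n%:R <= p%:R * l2norm v ^+ 2.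
Proof.
rewrite ler_pdivrMr// !l2norm_sqr.
apply: (@le_trans _ _ (\sum_i (\sum_j X i j ^+ 2) * (\sum_j v j 0 ^+ 2))).
  by apply: ler_sum => i _; rewrite mxE; exact: Cauchy_Schwarz_sqr.
rewrite -mulr_suml exchange_big/= (eq_bigr (fun=> n%:R)) => [|j _].
  by rewrite sumr_const card_ord -[n%:R *+ p]mulr_natl mulrAC.
by rewrite -(col_sqr j) l2norm_sqr; apply: eq_bigr => i _; rewrite mxE.
Qed.

(** For a fixed nonzero vector each of the two inequalities is a lower bound on [d], and lower
    bounds pass to the infimum of a nonempty set. *)
Lemma restricted_isometryP m (J : {set 'I_p}) (v : 'cV[R]_p) : (#|J| <= m)%N ->
  (1 - restricted_isometry X m) * l2norm (restr J v) ^+ 2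
    <= l2norm (X *m restr J v) ^+ 2 / n%:R
    <= (1 + restricted_isometry X m) * l2norm (restr J v) ^+ 2.
Proof.
move=> Jm; set N := l2norm (restr J v) ^+ 2; set Q := _ / n%:R.
have Q0 : 0 <= Q by rewrite divr_ge0// sqr_ge0.
have N0 : 0 <= N by rewrite sqr_ge0.
have [N_gt0|N_le0] := ltP 0 N; last first.
  have Neq : N = 0 by apply/eqP; rewrite eq_le N0 N_le0.
  have : Q = 0.
    rewrite /Q (@l2norm_eq0 _ (restr J v)).
      rewrite mulmx0 l2norm_sqr big1 ?mul0r// => i _.
      by rewrite mxE expr0n.
    by apply/eqP; rewrite -sqrf_eq0; apply/eqP.
  by move=> ->; rewrite Neq !mulr0 lexx.
(* The witness [p%:R] needs [1 - p%:R <= 0] for the lower inequality. *)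
have p0 : (0 < p)%N.
  rewrite lt0n; apply: contraTneq N_gt0 => p0; rewrite -leNgt /N l2norm_sqr.
  by rewrite big1// => i _; have := ltn_ord i; rewrite {2}p0.
rewrite /restricted_isometry; set D := [set d | _].
have D0 : D !=set0.
  exists p%:R => K c _; move: (zero_extend c) (zero_extend_enum c) => u ->.
  rewrite l2norm_sub_restr subcols_restr; apply/andP; split.
    rewrite (@le_trans _ _ 0)// ?divr_ge0// ?sqr_ge0//.
    by rewrite mulr_le0_ge0 ?sqr_ge0// subr_le0 ler1n.
  by apply: (le_trans (l2norm_mulmx_le _)); rewrite ler_wpM2r ?sqr_ge0// lerDr.
have Dv d : D d -> (1 - d) * N <= Q <= (1 + d) * N.
  by move=> /(_ J (\col_k v (enum_val k) 0) Jm);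
    rewrite l2norm_sub_restr subcols_restr.
have lb1 : 1 - Q / N <= inf D.
  apply: lb_le_inf => // d /Dv /andP[+ _].
  by rewrite -ler_pdivlMr// => h; lra.
have lb2 : Q / N - 1 <= inf D.
  apply: lb_le_inf => // d /Dv /andP[_].
  by rewrite -ler_pdivrMr// => h; lra.
apply/andP; split.
  by rewrite -ler_pdivlMr//; lra.
by rewrite -ler_pdivrMr//; lra.
Qed.

Lemma restricted_orthogonalityP m m' (J J' : {set 'I_p}) (u v : 'cV[R]_p) :
  [disjoint J & J']%B -> (#|J| <= m)%N -> (#|J'| <= m')%N ->
  `|dotp (X *m restr J u) (X *m restr J' v)| / n%:R <=
    restricted_orthogonality X m m' * l2norm (restr J u) * l2norm (restr J' v).
Proof.
move=> JJ Jm Jm'; set Q := _ / n%:R; rewrite -mulrA; set N := _ * l2norm _.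
have bound x y : `|dotp (X *m x) (X *m y)| / n%:R <=
  p%:R * (l2norm x * l2norm y).
  rewrite ler_pdivrMr// (le_trans (dotp_le _ _))//.
  rewrite -[leRHS]ger0_norm ?mulr_ge0 ?l2norm_ge0//.
  rewrite -[leLHS]ger0_norm ?mulr_ge0 ?l2norm_ge0//.
  rewrite -ler_sqr ?nnegrE// !real_normK ?num_real// !exprMn.
  have := l2norm_mulmx_le x; have := l2norm_mulmx_le y.
  rewrite !ler_pdivrMr// => hy hx.
  apply: (le_trans (ler_pM _ _ hx hy)); rewrite ?sqr_ge0//.
  by rewrite le_eqVlt; apply/orP; left; apply/eqP; ring.
have N0 : 0 <= N by rewrite mulr_ge0 ?l2norm_ge0.
have [N_gt0|N_le0] := ltP 0 N; last first.
  have Neq : N = 0 by apply/eqP; rewrite eq_le N0 N_le0.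
  by rewrite Neq mulr0; have := bound (restr J u) (restr J' v);
    rewrite -/N Neq mulr0.
rewrite -ler_pdivrMr//; apply: lb_le_inf.
  exists p%:R => K K' c c' _ _ _.
  move: (zero_extend c) (zero_extend_enum c) => x ->.
  move: (zero_extend c') (zero_extend_enum c') => y ->.
  by rewrite !l2norm_sub_restr !subcols_restr -mulrA.
move=> th /(_ J J' (\col_k u (enum_val k) 0) (\col_k v (enum_val k) 0) JJ Jm
  Jm').
by rewrite !l2norm_sub_restr !subcols_restr -mulrA => h; rewrite ler_pdivrMr.
Qed.

Lemma Lambda_minP m (v : 'cV[R]_p) : sparse m v ->
  Lambda_min X m * l2norm v ^+ 2 <= l2norm (X *m v) ^+ 2 / n%:R.
Proof.
move=> vm; have [->|v0] := eqVneq v 0.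
  have -> : l2norm (0 : 'cV[R]_p) ^+ 2 = 0.
    by rewrite l2norm_sqr big1// => i _; rewrite mxE expr0n.
  by rewrite mulr0 divr_ge0// sqr_ge0.
have vv0 : 0 < l2norm v ^+ 2.
  by rewrite exprn_gt0// lt_neqAle l2norm_ge0 andbT eq_sym;
    apply: contra v0 => /eqP/l2norm_eq0 ->.
rewrite -ler_pdivlMr// -[leRHS]mulrA -invfM; apply: ge_inf; last by exists v.
by exists 0 => _ [u _ <-]; apply: divr_ge0; [exact: sqr_ge0|apply: mulr_ge0;
  [exact: ler0n|exact: sqr_ge0]].
Qed.

(** Positivity of [m] and [p] makes the set of quotients nonempty, so that its infimum is not the
    default value 0. *)
Lemma le_Lambda_min m c : (0 < m)%N -> (0 < p)%N ->
  (forall v : 'cV[R]_p, sparse m v ->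
     c * l2norm v ^+ 2 <= l2norm (X *m v) ^+ 2 / n%:R) -> c <= Lambda_min X m.
Proof.
move=> m0 p0 hc; apply: lb_le_inf.
  pose v : 'cV[R]_p := \col_j (j == Ordinal p0)%:R.
  eexists; exists v => //; split.
    apply/eqP => /colP/(_ (Ordinal p0)); rewrite !mxE eqxx => /eqP.
    by rewrite oner_eq0.
  rewrite /sparse (leq_trans _ m0)// -(cards1 (Ordinal p0)) subset_leq_card//.
  apply/fintype.subsetP => j; rewrite !inE mxE.
  by case: (j == _); rewrite ?eqxx.
move=> _ [v [v0 vm] <-].
have vv0 : 0 < l2norm v ^+ 2.
  by rewrite exprn_gt0// lt_neqAle l2norm_ge0 andbT eq_sym;
    apply: contra v0 => /eqP/l2norm_eq0 ->.
by rewrite invfM mulrA ler_pdivlMr// hc.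
Qed.

End design.

(** * The noise event *)

Lemma Boole_inequality_fin (R : realType) (d : measure_display)
    (T : measurableType d) (P : probability T R) (I : finType)
    (B : I -> set T) (c : R) :
  (forall i, measurable (B i)) -> (forall i, P (B i) <= c%:E)%E ->
  (P (\big[setU/set0]_(i : I) B i) <= (#|I|%:R * c)%:E)%E.
Proof.
move=> mB Bc; rewrite cardE /= -[index_enum I]enumT.
elim: (enum I) => [|i r IH]; first by rewrite big_nil measure0 mul0r.
rewrite big_cons; apply: (le_trans (measureU2 _ _ _)) => //.
  exact: bigsetU_measurable.
by rewrite /= -natr1 mulrDl mul1r addrC EFinD; apply: leeD => //; exact: IH.
Qed.

(** Half the square of [t] is (1 + a) ln p, so the density at [t] is p^-(1 + a) over sqrt(2 pi). The
    union bound over p columns leaves p^-a, and the left side equals the right side divided by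
    sqrt(1 + a), which is at least 1. *)
Lemma normal_pdf_ln_bound (R : realType) (p : nat) (a t : R) :
  (1 < p)%N -> 0 < a -> t = Num.sqrt (1 + a) * Num.sqrt (2 * ln p%:R) ->
  p%:R * (2 * (normal_pdf 0 1 t / t)) <=
    (Num.sqrt (pi * ln p%:R) * p%:R `^ a)^-1.
Proof.
move=> p1 a0 tE.
have p0 : 0 < p%:R :> R by rewrite ltr0n (ltn_trans _ p1).
have lnp : 0 < ln p%:R :> R by rewrite ln_gt0// ltr1n.
have a1 : 0 < 1 + a by lra.
have sa : 1 <= Num.sqrt (1 + a).
  by rewrite -[X in X <= _]sqrtr1 ler_sqrt; lra.
have pa : 0 < p%:R `^ a by exact: powR_gt0.
have t2 : t ^+ 2 = (1 + a) * (2 * ln p%:R).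
  by rewrite tE exprMn !sqr_sqrtr ?mulr_ge0 ?(ltW lnp) ?(ltW a1).
have -> : normal_pdf 0 1 t =
    (Num.sqrt 2 * Num.sqrt pi)^-1 * (p%:R * p%:R `^ a)^-1.
  rewrite normal_pdfE ?oner_eq0// /normal_peak /normal_fun; congr (_ * _).
    by rewrite expr1n mul1r -mulr_natl sqrtrM.
  rewrite subr0 t2 expr1n -[X in (X * _)^-1](lnK (_ : p%:R \is Num.pos))//.
  rewrite /powR gt_eqF// -expRD -expRN; congr expR; by field.
have s2 : 0 < Num.sqrt 2 :> R by rewrite sqrtr_gt0.
have sp : 0 < Num.sqrt pi :> R by rewrite sqrtr_gt0 pi_gt0.
have sl : 0 < Num.sqrt (ln p%:R) :> R by rewrite sqrtr_gt0.
rewrite tE (@sqrtrM _ 2)// (@sqrtrM _ pi) ?pi_ge0//.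
have s22 : Num.sqrt 2 * Num.sqrt 2 = 2 :> R by rewrite -expr2 sqr_sqrtr.
have -> : p%:R * (2 * ((Num.sqrt 2 * Num.sqrt pi)^-1 * (p%:R * p%:R `^ a)^-1 /
     (Num.sqrt (1 + a) * (Num.sqrt 2 * Num.sqrt (ln p%:R))))) =
   (Num.sqrt pi * Num.sqrt (ln p%:R) * p%:R `^ a)^-1 / Num.sqrt (1 + a).
  rewrite -[X in _ * (X * _)]s22; field.
  by rewrite !gt_eqF//= (lt_le_trans _ sa).
apply: ler_piMr; last by rewrite invf_le1// (lt_le_trans ltr01 sa).
by rewrite invr_ge0 !mulr_ge0// ltW.
Qed.

Lemma noise_event (R : realType) (d : measure_display) (T : measurableType d)
    (P : probability T R) (n p : nat) (X : 'M[R]_(n, p))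
    (eps : 'I_n -> {RV P >-> R}) (sigma a : R) :
  (forall j : 'I_p, l2norm (col j X) = Num.sqrt n%:R) ->
  (0 < n)%N -> (1 < p)%N -> 0 < sigma -> 0 < a ->
    isotropic_gaussian eps sigma ->
  prob_at_least P
    [set w | forall j, `|dotp (col j X) (\col_i eps i w)| / n%:R <=
       Num.sqrt (1 + a) * (universal_level R n p * sigma)]
    (1 - (Num.sqrt (pi * ln p%:R) * p%:R `^ a)^-1).
Proof.
move=> hX n0 p1 s0 a0 heps.
have nR : 0 < n%:R :> R by rewrite ltr0n.
have lnp : 0 < ln p%:R :> R by rewrite ln_gt0// ltr1n.
pose W j w := \sum_(i < n) (X i j / n%:R) * eps i w.
pose nu := Num.sqrt (1 + a) * (universal_level R n p * sigma).
have WE j w : `|dotp (col j X) (\col_i eps i w)| / n%:R = `|W j w|.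
  rewrite -[n%:R in LHS](ger0_norm (ltW nR)) -normf_div; congr `|_|.
  by rewrite mulr_suml; apply: eq_bigr => i _; rewrite !mxE mulrAC.
pose B j := [set w | nu < `|W j w|].
have mW j : measurable_fun setT (W j).
  by apply: measurable_sum => i; exact: measurable_funM.
have mB j : measurable (B j).
  rewrite (_ : B j = (fun w => `|W j w|) @^-1` `]nu, +oo[%classic).
    by rewrite -[X in measurable X]setTI; exact: measurableT_comp.
  by apply/seteqP; split => w /=; rewrite in_itv/= andbT.
pose t := Num.sqrt (1 + a) * Num.sqrt (2 * ln p%:R) : R.
have t0 : 0 < t by rewrite mulr_gt0// sqrtr_gt0 ?mulr_gt0//; lra.
pose q := Num.sqrt n%:R^-1 : R.
have q0 : 0 < q by rewrite sqrtr_gt0 invr_gt0.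
have PB j : (P (B j) <= (2 * (normal_pdf 0 1 t / t))%:E)%E.
  have mA : measurable [set x : R | nu < `|x|].
    rewrite (_ : [set _ | _] = (fun x : R => `|x|) @^-1` `]nu, +oo[%classic).
      by rewrite -[X in measurable X]setTI; exact: normr_measurable.
    by apply/seteqP; split => x /=; rewrite in_itv/= andbT.
  have := normal_sum_law (fun i => X i j / n%:R) s0 heps mA.
  rewrite -/(W j) => PE.
  rewrite [P _]PE; apply: le_trans (normal_abs_tail_le t0).
  (* Columns have squared norm n, so [W j] has standard deviation [sigma * q], and [nu] is [t] times
     that. *)
  have -> : [set x | [set x0 : R | nu < `|x0|]
      (sigma * Num.sqrt (\sum_(i < n) (X i j / n%:R) ^+ 2) * x)] =
      [set x : R | t < `|x|].
    have -> : \sum_(i < n) (X i j / n%:R) ^+ 2 = n%:R^-1.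
      transitivity ((\sum_i X i j ^+ 2) / n%:R ^+ 2).
        by rewrite mulr_suml; apply: eq_bigr => i _; rewrite expr_div_n.
      have -> : \sum_i X i j ^+ 2 = n%:R.
        by rewrite -(col_sqr hX j) l2norm_sqr; apply: eq_bigr => i _;
          rewrite mxE.
      by field; rewrite gt_eqF.
    rewrite -/q.
    have -> : nu = sigma * q * t.
      rewrite /nu /universal_level sqrtrM ?mulr_ge0 ?(ltW lnp)// -/q /t; ring.
    apply/seteqP; split => x /=;
      by rewrite normrM (ger0_norm (ltW (mulr_gt0 s0 q0))) ltr_pM2l// mulr_gt0.
  by [].
exists (~` \big[setU/set0]_(j : 'I_p) B j); split.
- by apply: measurableC; exact: bigsetU_measurable.
- move=> w /= nB j; rewrite WE leNgt; apply/negP => Bw; apply: nB.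
  by rewrite -bigcup_seq; exists j => //=; rewrite mem_index_enum.
- rewrite probability_setC; last exact: bigsetU_measurable.
  have := Boole_inequality_fin mB PB; rewrite card_ord => Bl.
  rewrite EFinB leeB//; apply: (le_trans Bl).
  by rewrite lee_fin; exact: (@normal_pdf_ln_bound _ _ a).
Qed.

(** * The Dantzig selector *)

Section lasso.
Variables (R : realType) (n p : nat) (X : 'M[R]_(n, p)).
Hypothesis hX : forall j : 'I_p, l2norm (col j X) = Num.sqrt n%:R.
Hypothesis n0 : (0 < n)%N.
Let nR : 0 < n%:R :> R. Proof. by rewrite ltr0n. Qed.

Lemma l2normD_sqr k (u v : 'cV[R]_k) :
  l2norm (u + v) ^+ 2 = l2norm u ^+ 2 + 2 * dotp u v + l2norm v ^+ 2.
Proof.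
by rewrite -!dotpvv dotpDl !(dotpC _ (u + v)) !dotpDl (dotpC v u); ring.
Qed.

Lemma l2normN k (u : 'cV[R]_k) : l2norm (- u) = l2norm u.
Proof. by congr Num.sqrt; apply: eq_bigr => i _; rewrite mxE sqrrN. Qed.

Lemma l2normZ_sqr k c (u : 'cV[R]_k) :
  l2norm (c *: u) ^+ 2 = c ^+ 2 * l2norm u ^+ 2.
Proof. by rewrite -!dotpvv dotpZl dotpC dotpZl mulrA. Qed.

Lemma dantzig_feasibleP (Y : 'cV[R]_n) (lam : R) (b : 'cV[R]_p) : 0 <= lam ->
  dantzig_feasible X Y lam b <->
  forall j, `|dotp (col j X) (Y - X *m b)| / n%:R <= lam.
Proof.
move=> lam0; rewrite /dantzig_feasible /mx_norm.
have E j : `|(n%:R^-1 *: (X^T *m (Y - X *m b))) j 0| =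
    `|dotp (col j X) (Y - X *m b)| / n%:R.
  rewrite mxE normrM [`|n%:R^-1|]ger0_norm ?invr_ge0// mulrC; congr (`|_| / _).
  by rewrite mxE; apply: eq_bigr => i _; rewrite !mxE.
split=> [h j|h].
  rewrite -E; apply: le_trans h; rewrite -/(mx_norm _) mx_normrE.
  exact: (le_bigmax _ (fun ij : 'I_p * 'I_1 => `|_ ij.1 ij.2|) (j, 0)).
rewrite -/(mx_norm _) mx_normrE; apply: bigmax_le => // -[j k] _ /=.
by rewrite (ord1 k) E.
Qed.

(* An approximate Lasso solution satisfies the stationarity inequality up to
   a factor two, so that no exact minimiser is needed. *)
Lemma lasso_correlation_bound (y : 'cV[R]_n) (k : R) : 0 < k ->
  exists b : 'cV[R]_p,
    (forall j, `|dotp (col j X) (X *m b - y)| / n%:R <= k) /\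
    k * l1norm b <= l2norm y ^+ 2 / n%:R.
Proof.
move=> k0; pose F b := l2norm (X *m b - y) ^+ 2 / n%:R / 2 + k / 2 * l1norm b.
have l1_ge0 (b : 'cV[R]_p) : 0 <= l1norm b by apply: sumr_ge0.
have sq_ge0 (v : 'cV[R]_n) : 0 <= l2norm v ^+ 2 / n%:R.
  by rewrite divr_ge0// sqr_ge0.
have F0 b : 0 <= F b.
  apply: addr_ge0; apply: mulr_ge0 => //.
  by rewrite divr_ge0// ltW.
have infE : has_inf (range F).
  split; first by exists (F 0), 0.
  by exists 0 => _ [b _ <-].
(* With this error, moving one coordinate by k/2 either way yields exactly the correlation bound
   [k], twice the stationarity level k/2 of an exact minimiser of [F]. *)
have k8 : 0 < k ^+ 2 / 8 by rewrite divr_gt0// exprn_gt0.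
have [_ [b1 _ <-] b1F] := inf_adherent k8 infE.
(* Doing no worse than 0 is what bounds the l1 norm. *)
pose b := if F b1 <= F 0 then b1 else 0.
have bF0 : F b <= F 0 by rewrite /b; case: ifP.
have bF c : F b <= F c + k ^+ 2 / 8.
  have : inf (range F) <= F c by apply: ge_inf; [case: infE|exists c].
  move=> cF; have : F b <= F b1.
    by rewrite /b; case: ifPn => //; rewrite -ltNge => /ltW.
  by lra.
exists b; split; last first.
  move: bF0; rewrite /F mulmx0 sub0r l2normN.
  have -> : l1norm (0 : 'cV[R]_p) = 0.
    by rewrite /l1norm big1// => i _; rewrite mxE normr0.
  by have := sq_ge0 (X *m b - y); lra.
move=> j; pose g := dotp (col j X) (X *m b - y) / n%:R.
have -> : `|dotp (col j X) (X *m b - y)| / n%:R = `|g|.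
  by rewrite normrM (ger0_norm (_ : 0 <= n%:R^-1))// invr_ge0.
have key t : - (k ^+ 2 / 8) <= t * g + t ^+ 2 / 2 + k / 2 * `|t|.
  pose bt := b + t *: delta_mx j 0.
  have e1 : l2norm (X *m bt - y) ^+ 2 / n%:R =
      l2norm (X *m b - y) ^+ 2 / n%:R + 2 * t * g + t ^+ 2.
    have -> : X *m bt - y = (X *m b - y) + t *: col j X.
      by rewrite /bt mulmxDr -scalemxAr -colE addrAC.
    rewrite l2normD_sqr l2normZ_sqr (col_sqr hX) dotpC dotpZl /g; field.
    by rewrite gt_eqF.
  have e2 : l1norm bt <= l1norm b + `|t|.
    have -> : `|t| = \sum_(i < p) `|(t *: delta_mx j 0 : 'cV[R]_p) i 0|.
      rewrite (bigD1 j)//= !mxE !eqxx mulr1 big1 ?addr0// => i ij.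
      by rewrite !mxE (negbTE ij) mulr0 normr0.
    rewrite -big_split; apply: ler_sum => i _ /=.
    by rewrite mxE; exact: ler_normD.
  have := bF bt; rewrite /F e1.
  have := ler_wpM2l (_ : 0 <= k / 2) e2;
    rewrite divr_ge0 ?(ltW k0)// => /(_ isT).
  by rewrite mulrDr; lra.
have kh : 0 <= k / 2 by rewrite divr_ge0// ltW.
have k2 := key (k / 2); have k3 := key (- (k / 2)).
rewrite normrN in k3; rewrite (ger0_norm kh) in k2 k3.
rewrite ler_norml; apply/andP; split.
  have : 0 <= k * (g + k) by lra.
  by rewrite pmulr_rge0//; lra.
have : 0 <= k * (k - g) by lra.
by rewrite pmulr_rge0//; lra.
Qed.
End lasso.

(** * Cone condition and l2 bound *)

Section cone.
Variables (R : realType) (n p : nat) (X : 'M[R]_(n, p)).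
Hypothesis hX : forall j : 'I_p, l2norm (col j X) = Num.sqrt n%:R.
Hypothesis n0 : (0 < n)%N.
Let nR : 0 < n%:R :> R. Proof. by rewrite ltr0n. Qed.

(** The left side is the constant that the cone argument produces: 2 sqrt 2 from the correlations
    over at most 2 s0 coordinates, 1 + delta from the image of the tail of [beta], theta (1 + delta)
    from the l1 norm of the Lasso fit. *)
Lemma C0'_lower_bound (delta theta : R) : 0 <= delta -> 0 <= theta ->
  0 < 1 - delta - theta ->
  2 * Num.sqrt 2 + (1 + delta) + theta * (1 + delta) <=
  (1 - delta - theta) * C0' delta theta.
Proof.
move=> d0 t0; rewrite /C0' /C0; set x := 1 - delta - theta => x0.
have q0 : 0 <= Num.sqrt 2 :> R by exact: sqrtr_ge0.
have q1 : 1 <= Num.sqrt 2 :> R.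
  by rewrite -[X in X <= _]sqrtr1 ler_sqrt// ler1n.
set q := Num.sqrt 2 in q0 q1 *.
have x1 : x <= 1 by rewrite /x; lra.
have e1 : 1 + delta <= (1 - delta ^+ 2) / x.
  rewrite ler_pdivlMr//.
  have : 0 <= (1 + delta) * theta by rewrite mulr_ge0//; lra.
  by rewrite /x; lra.
have e2 : 0 <= (1 + q^-1) * ((1 + delta) ^+ 2 / x).
  rewrite mulr_ge0 ?divr_ge0 ?sqr_ge0 ?(ltW x0)//.
  by rewrite addr_ge0// invr_ge0.
have e3 : theta * (1 + delta) <= theta * (1 + delta) / x.
  rewrite ler_pdivlMr// ler_piMr// mulr_ge0//; lra.
have e4 : q * (1 + delta) <= q * ((1 - delta ^+ 2) / x) by rewrite ler_wpM2l.
have e5 : 1 + delta <= q * (1 + delta) by rewrite ler_peMl//; lra.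
have E Z : x * (Z / x + theta * (1 + delta) / x ^+ 2) =
    Z + theta * (1 + delta) / x.
  by field; rewrite gt_eqF.
rewrite E {E}.
have : 0 <= (1 - delta ^+ 2) / x by apply: le_trans e1; lra.
move: e4 e1 e2 e3 e5; set A := (1 - delta ^+ 2) / x; set B := (_ + _) * (_ / _).
set C := _ / x; move=> e4 e1 e2 e3 e5 A0.
have -> : 2 * q * (1 + A) = 2 * q + 2 * (q * A) by ring.
by lra.
Qed.

Lemma dantzig_cone_bound (beta b : 'cV[R]_p) (e : 'cV[R]_n) (T0 : {set 'I_p})
    (s s0 : nat) (tau l0 nu : R) :
  let delta := restricted_isometry X (2 * s) in
  let theta := restricted_orthogonality X s (2 * s) in
  let ln := nu + l0 / tau in
  let h := b - restr T0 beta in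
  0 <= delta -> 0 <= theta -> 0 < tau -> delta + theta < 1 - tau ->
  0 < l0 -> 0 <= nu ->
  (0 < s0)%N -> (s0 <= s)%N -> sparse s beta -> #|T0| = s0 ->
  \sum_(j in ~: T0) beta j 0 ^+ 2 <= s0%:R * l0 ^+ 2 ->
  (forall j, `|dotp (col j X) e| / n%:R <= nu) ->
  dantzig_selector X (X *m beta + e) ln b ->
  exists T1 : {set 'I_p}, [/\ T1 \subset ~: T0, (#|T1| <= s0)%N,
    T1 = ~: T0 \/ #|T1| = s0,
    (forall i j, i \in T1 -> j \in ~: T0 :\: T1 -> `|h j 0| <= `|h i 0|) &
    Num.sqrt (\sum_(j in T0 :|: T1) h j 0 ^+ 2) <=
      C0' delta theta * ln * Num.sqrt s0%:R].
Proof.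
move=> delta theta ln h d0 th0 tau0 dth l00 nu0 s00 s0s sb T0s tail he [feas
  min].
have k0 : 0 < l0 / tau by rewrite divr_gt0.
have d1 : 0 <= 1 + delta by lra.
have tau1 : tau <= 1 by lra.
have ln0 : 0 <= ln by rewrite /ln addr_ge0// ltW.
have x0 : 0 < 1 - delta - theta by lra.
have ltau : l0 <= tau * ln.
  by rewrite /ln mulrDr mulrCA divff ?gt_eqF// mulr1 lerDr mulr_ge0// ltW.
have s02s : (2 * s0 <= 2 * s)%N by rewrite leq_mul2l.
pose sq := Num.sqrt s0%:R : R.
have sq0 : 0 < sq by rewrite sqrtr_gt0 ltr0n.
have sqE : sq ^+ 2 = s0%:R by rewrite sqr_sqrtr.
pose b2 := restr (~: T0) beta.
have bE : beta = restr T0 beta + b2.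
  by apply/colP => j; rewrite !mxE inE; case: (j \in T0); rewrite ?addr0 ?add0r.
have b2S : b2 = restr (supp beta :\: T0) b2.
  apply/esym/restrT => j; rewrite !inE negb_and negbK mxE inE.
  by case: (j \in T0) => //=; rewrite negbK => /eqP.
have b2n : l2norm b2 <= sq * l0.
  rewrite l2norm_restr -(ger0_norm (ltW l00)) -sqrtr_sqr -sqrtrM//.
  by rewrite ler_sqrt// mulr_ge0// sqr_ge0.
have Xb2 : l2norm (X *m b2) ^+ 2 / n%:R <= (1 + delta) * (sq * l0) ^+ 2.
  have cS : (#|supp beta :\: T0| <= 2 * s)%N.
    apply: (leq_trans (subset_leq_card (finset.subsetDl _ _))).
    by rewrite (leq_trans sb)// leq_pmull.
  have /andP[_] := restricted_isometryP hX n0 b2 cS.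
  rewrite -b2S => h1; apply: (le_trans h1); rewrite ler_wpM2l//.
  by rewrite lerXn2r ?nnegrE ?l2norm_ge0// mulr_ge0// ltW.
(* [b'] stands in for [b2]. Its level [l0 / tau] is the part of [ln] left over by the noise level
   [nu], which makes [restr T0 beta + b'] feasible. *)
have [b' [b'c b'l]] := lasso_correlation_bound hX n0 (X *m b2) k0.
pose B := l1norm b'.
have Bb : B <= (1 + delta) * sq ^+ 2 * l0 * tau.
  have : l0 / tau * B <= l0 / tau * ((1 + delta) * sq ^+ 2 * l0 * tau).
    apply: (le_trans b'l); apply: (le_trans Xb2); rewrite le_eqVlt.
    by apply/orP; left; apply/eqP; field; rewrite gt_eqF.
  by rewrite ler_pM2l.
have B0 : 0 <= B by apply: sumr_ge0.
have l1b : l1norm b <= (\sum_(j in T0) `|beta j 0|) + B.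
  have -> : \sum_(j in T0) `|beta j 0| = l1norm (restr T0 beta).
    by rewrite /l1norm (@restr_sum _ _ T0 beta (fun _ x => `|x|))// normr0.
  apply: (@le_trans _ _ (l1norm (restr T0 beta + b'))); last first.
    by rewrite -big_split; apply: ler_sum => j _; rewrite mxE ler_normD.
  apply: min; apply/(dantzig_feasibleP _ _ _ ln0) => j.
  have -> : X *m beta + e - X *m (restr T0 beta + b') = e - (X *m b' - X *m b2).
    by rewrite {1}bE !mulmxDr; apply/colP => i; rewrite !mxE; ring.
  rewrite dotpBr.
  apply: (@le_trans _ _ ((`|dotp (col j X) e| +
    `|dotp (col j X) (X *m b' - X *m b2)|) / n%:R)).
    by rewrite ler_pM2r ?invr_gt0// ler_normB.
  by rewrite mulrDl lerD.
have hE j : h j 0 = b j 0 - (if j \in T0 then beta j 0 else 0) by rewrite !mxE.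
have cone : \sum_(j in ~: T0) `|h j 0| <= \sum_(j in T0) `|h j 0| + B.
  have : l1norm b = \sum_(j in T0) `|b j 0| + \sum_(j in ~: T0) `|h j 0|.
    rewrite /l1norm (bigID (mem T0))/=; congr (_ + _).
    apply: eq_big => [j|j jT]; first by rewrite inE.
    by rewrite hE (negbTE jT) subr0.
  have : \sum_(j in T0) `|beta j 0| <= \sum_(j in T0) `|b j 0| +
    \sum_(j in T0) `|h j 0|.
    rewrite -big_split; apply: ler_sum => j jT /=.
    rewrite hE jT distrC; have := ler_normD (b j 0) (beta j 0 - b j 0).
    by rewrite subrKC.
  by lra.
(* If fewer than s0 coordinates lie outside T0, [T1] takes them all and nothing remains to peel. *)
have [T1 [T1s T1c T1or T1top T1sum]] : exists T1 : {set 'I_p},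
  [/\ T1 \subset ~: T0, (#|T1| <= s0)%N,
    T1 = ~: T0 \/ #|T1| = s0,
    (forall i j, i \in T1 -> j \in ~: T0 :\: T1 -> `|h j 0| <= `|h i 0|) &
    forall j, j \in ~: T0 :\: T1 -> `|h j 0| <=
      (\sum_(j in T1) `|h j 0|) / s0%:R].
  have [cT|cT] := leqP s0 #|~: T0|; last first.
    exists (~: T0); split; rewrite ?(ltnW cT)//; first by left.
      by move=> i j _; rewrite finset.setDv finset.in_set0.
    by move=> j; rewrite finset.setDv finset.in_set0.
  have [T1 [T1s T1c T1t]] := exists_largest (fun j => `|h j 0|) cT.
  exists T1; split; rewrite ?T1c//; first by right.
  move=> j jT; rewrite ler_pdivlMr ?ltr0n// mulr_natr -T1c -sumr_const.
  by apply: ler_sum => i iT; exact: T1t.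
exists T1; split => //.
set J := T0 :|: T1.
have T01 : [disjoint T0 & T1]%B.
  by rewrite finset.disjoints_subset -finset.setCS finset.setCK.
have Jc : (#|J| <= 2 * s0)%N.
  rewrite mul2n -addnn; apply: (leq_trans (leq_card_setU _ _)).
  by rewrite T0s leq_add2l.
pose u := restr J h; pose N := l2norm u.
have NE : Num.sqrt (\sum_(j in J) h j 0 ^+ 2) = N by rewrite /N l2norm_restr.
rewrite NE.
have N0 : 0 <= N by exact: l2norm_ge0.
have /andP[rip1 rip2] := restricted_isometryP hX n0 h (leq_trans Jc s02s).
rewrite -/u -/N -/delta in rip1 rip2.
pose v := restr (~: J) h.
have huv : h = u + v.
  by apply/colP => j; rewrite !mxE finset.in_setC; case: (j \in J);
    rewrite ?addr0 ?add0r.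
have hT0 : \sum_(j in T0) `|h j 0| <= sq * N.
  apply: (le_trans (l1_le_l2 _ _)); rewrite T0s ler_pM2l// /N l2norm_restr
    ler_sqrt.
    rewrite [leRHS](big_setID T0)/=.
    have -> : J :&: T0 = T0 by apply/finset.setIidPr; exact: finset.subsetUl.
    by rewrite lerDl sumr_ge0// => j _; exact: sqr_ge0.
  by apply: sumr_ge0 => j _; exact: sqr_ge0.
(* Peeling starts with the average over [T1] as the bound on entries, so the mass of [T1] pays for
   the first block and the total is the l1 norm over the whole complement of T0. *)
have shell : `|dotp (X *m u) (X *m v)| / n%:R <=
    theta * N * ((\sum_(j in ~: T0) `|h j 0|) / sq).
  pose phi (A : {set 'I_p}) := `|dotp (X *m u) (X *m restr A h)| / n%:R.
  have thN : 0 <= theta * N by rewrite mulr_ge0.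
  have JC : ~: J = ~: T0 :\: T1.
    by apply/setP => j; rewrite !inE negb_or andbC.
  have phiD (A A' : {set 'I_p}) : A \subset ~: J -> A' \subset A ->
      phi A <= phi A' + phi (A :\: A').
    move=> _ A'A; rewrite /phi -mulrDl ler_pM2r ?invr_gt0//.
    have -> : restr A h = restr A' h + restr (A :\: A') h.
      rewrite -restrU; last first.
        rewrite -finset.setI_eq0; apply/eqP/setP => j; rewrite !inE.
        by case: (j \in A').
      by congr restr; rewrite -{1}(finset.setID A A') (finset.setIidPr A'A).
    rewrite mulmxDr dotpDr.
    exact: ler_normD.
  have phiK (A : {set 'I_p}) : A \subset ~: J -> (#|A| <= s0)%N ->
      phi A <= theta * N * Num.sqrt (\sum_(i in A) h i 0 ^+ 2).
    move=> AJ As; rewrite /phi dotpC.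
    have dAJ : [disjoint A & J]%B by rewrite finset.disjoints_subset.
    have := restricted_orthogonalityP hX n0 h h dAJ (leq_trans As s0s)
      (leq_trans Jc s02s).
    by rewrite -/u -/N -/theta -l2norm_restr mulrAC.
  have [JT|JT] := T1or.
    have -> : v = 0.
      apply/colP => j; rewrite !mxE JC JT finset.setDv finset.in_set0//.
    have -> : dotp (X *m u) (X *m 0) = 0.
      by rewrite mulmx0 /dotp big1// => i _; rewrite [X in _ * X]mxE mulr0.
    by rewrite normr0 mul0r mulr_ge0// divr_ge0 ?(ltW sq0)// sumr_ge0.
  have M0 : 0 <= (\sum_(j in T1) `|h j 0|) / s0%:R by rewrite divr_ge0//
    sumr_ge0.
  have := shelling thN s00 phiD phiK (subxx _) M0.
  rewrite -/sq {1}JC => /(_ T1sum) hs.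
  apply: (le_trans hs); rewrite ler_wpM2l//.
  rewrite [in leRHS](big_setID T1)/= (finset.setIidPr T1s) -JC mulrDl lerD2r.
  rewrite -sqE le_eqVlt; apply/orP; left; apply/eqP; field; exact: lt0r_neq0.
have XbE : X *m (b - beta) = e - (X *m beta + e - X *m b).
  by rewrite mulmxBr; apply/colP => i; rewrite !mxE; ring.
(* The noise and the residual of [b] both have correlations at most [ln], whence [2 * ln];
   [Num.sqrt 2 * sq] comes from Cauchy-Schwarz on the at most 2 s0 coordinates of [J]. *)
have hcor : `|dotp (X *m u) (X *m (b - beta))| / n%:R <=
  (2 * ln) * (Num.sqrt 2 * sq * N).
  have ln20 : 0 <= 2 * ln by rewrite mulr_ge0.
  have hc j : `|dotp (col j X) (X *m (b - beta))| / n%:R <= 2 * ln.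
    rewrite XbE dotpC dotpDl dotpNl !(dotpC _ (col j X)).
    apply: (@le_trans _ _ ((`|dotp (col j X) e| + `|dotp (col j X) (X *m beta +
      e - X *m b)|) / n%:R)).
      by rewrite ler_pM2r ?invr_gt0// ler_normB.
    rewrite mulrDl; have := proj1 (dantzig_feasibleP _ _ _ ln0) feas j.
    by have := he j; rewrite /ln; lra.
  apply: (@le_trans _ _ (2 * ln * \sum_(j in J) `|h j 0|)).
    rewrite ler_pdivrMr// dotp_mulmx.
    rewrite (@restr_sum _ _ J h (fun j x =>
      x * dotp (col j X) (X *m (b - beta)))) => [|j]; last by rewrite mul0r.
    apply: (le_trans (ler_norm_sum _ _ _)); rewrite mulrAC mulr_sumr.
    apply: ler_sum => j _; rewrite normrM mulrC ler_wpM2r//.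
    by rewrite -ler_pdivrMr.
  rewrite ler_wpM2l//; apply: (le_trans (l1_le_l2 _ _)); rewrite NE ler_wpM2r//.
  by rewrite -sqrtrM// ler_sqrt ?mulr_ge0// -natrM ler_nat.
have hb2 : `|dotp (X *m u) (X *m b2)| / n%:R <= (1 + delta) * N * (sq * l0).
  have r0 : 0 <= (1 + delta) * N * (sq * l0) by rewrite !mulr_ge0// ltW.
  rewrite ler_pdivrMr// (le_trans (dotp_le _ _))//.
  have y0 : 0 <= (1 + delta) * N * (sq * l0) * n%:R by rewrite mulr_ge0.
  have z0 : 0 <= l2norm (X *m u) * l2norm (X *m b2) by rewrite mulr_ge0
    ?l2norm_ge0.
  rewrite -(@ler_pXn2r _ 2) ?nnegrE//.
  rewrite exprMn; move: rip2 Xb2; rewrite !ler_pdivrMr// => r1 r2.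
  apply: (le_trans (ler_pM (sqr_ge0 _) (sqr_ge0 _) r1 r2)).
  by rewrite le_eqVlt; apply/orP; left; apply/eqP; ring.
(* As [h] equals both [u + v] and [b - beta + b2], pairing [X *m u] with itself splits into the
   three terms just bounded. *)
have main : (1 - delta) * N ^+ 2 <= N * (2 * ln * (Num.sqrt 2 * sq) +
    (1 + delta) * (sq * l0) + theta * ((sq * N + B) / sq)).
  apply: (le_trans rip1); rewrite -dotpvv.
  have -> : dotp (X *m u) (X *m u) = dotp (X *m u) (X *m (b - beta)) +
     dotp (X *m u) (X *m b2) - dotp (X *m u) (X *m v).
    rewrite -dotpDr -dotpBr; congr dotp.
    rewrite -!mulmxDr -mulmxBr; congr (X *m _).
    have -> : b - beta + b2 = h by rewrite {1}bE opprD addrA subrK.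
    by rewrite huv addrK.
  rewrite mulrDl mulrDl.
  have n1 (x : R) : x / n%:R <= `|x| / n%:R by rewrite ler_pM2r ?invr_gt0//
    ler_norm.
  have := n1 (dotp (X *m u) (X *m (b - beta))).
  have := n1 (dotp (X *m u) (X *m b2)).
  have := n1 (- dotp (X *m u) (X *m v)); rewrite normrN => q1 q2 q3.
  have q4 : theta * N * ((\sum_(j in ~: T0) `|h j 0|) / sq) <=
    theta * N * ((sq * N + B) / sq).
    rewrite ler_wpM2l ?mulr_ge0// ler_pM2r ?invr_gt0//; lra.
  move: hcor hb2 shell q1 q2 q3 q4.
  by clearbody ln; move=> /= w1 w2 w3 q1 q2 q3 q4; lra.
(* One factor [N] cancels, and the [theta * N] contributed by the cone condition moves to the
   left. *)
have main2 : (1 - delta - theta) * N <= sq * ln *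
    (2 * Num.sqrt 2 + (1 + delta) + theta * (1 + delta)).
  have lln : l0 <= ln.
    by apply: (le_trans ltau); rewrite ler_piMl.
  have Bs : B / sq <= (1 + delta) * (sq * ln).
    rewrite ler_pdivrMr//; apply: (le_trans Bb).
    have -> : (1 + delta) * (sq * ln) * sq = ((1 + delta) * sq ^+ 2) * ln.
      by ring.
    rewrite -mulrA ler_wpM2l//; first by rewrite mulr_ge0 ?sqr_ge0.
    by rewrite (le_trans _ lln)// ler_piMr// ltW.
  have [->|Nn0] := eqVneq N 0.
    rewrite mulr0 mulr_ge0// ?mulr_ge0 ?(ltW sq0)//.
    by rewrite !addr_ge0// ?mulr_ge0// ?sqrtr_ge0.
  have Ng : 0 < N by rewrite lt_neqAle eq_sym Nn0.
  have fE : (sq * N + B) / sq = N + B / sq by field; exact: lt0r_neq0.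
  move: main; rewrite expr2 mulrCA ler_pM2l// fE => main.
  have t1 : theta * (B / sq) <= theta * ((1 +
    delta) * (sq * ln)) by rewrite ler_wpM2l.
  have t2 : (1 + delta) * (sq * l0) <= (1 + delta) * (sq * ln).
    by rewrite ler_wpM2l// ler_wpM2l// ltW.
  clearbody ln.
  have -> : sq * ln * (2 * Num.sqrt 2 + (1 + delta) + theta * (1 + delta)) =
    2 * ln * (Num.sqrt 2 * sq) + (1 + delta) * (sq * ln) + theta * ((1 +
      delta) * (sq * ln)) by ring.
  by lra.
have := C0'_lower_bound d0 th0 x0.
move=> /(ler_wpM2l (_ : 0 <= sq * ln)); rewrite mulr_ge0 ?(ltW sq0)// =>
  /(_ isT) c0.
have := le_trans main2 c0; rewrite mulrCA ler_pM2l//.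
by rewrite (mulrC (sq * ln)) (mulrC sq) mulrA.
Qed.

End cone.

(** * Least squares on the selected columns *)

Section ols.
Variables (R : realType) (n p : nat) (X : 'M[R]_(n, p)).
Hypothesis n0 : (0 < n)%N.

Lemma zero_extend_notin (J : {set 'I_p}) (v : 'cV[R]_#|J|) j :
  j \notin J -> zero_extend v j 0 = 0.
Proof.
move=> jJ; rewrite mxE big1// => k /eqP kj; move: jJ.
by rewrite -kj enum_valP.
Qed.

Lemma subcols_zero_extend (J : {set 'I_p}) (v : 'cV[R]_#|J|) :
  subcols X J *m v = X *m zero_extend v.
Proof.
rewrite [in LHS](zero_extend_enum v) subcols_restr restrT//.
exact: zero_extend_notin.
Qed.

(** A kernel vector of the Gram matrix has zero image under X, so the lower bound forces it to
    vanish. This excludes the default value of [invmx]. *)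
Lemma gram_unit (J : {set 'I_p}) (c : R) : 0 < c ->
  (forall v, c * l2norm (restr J v) ^+ 2 <= l2norm (X *m restr J v) ^+
    2 / n%:R) ->
  (subcols X J)^T *m subcols X J \in unitmx.
Proof.
move=> c0 hc; rewrite -row_free_unit; apply: inj_row_free => v vG.
have : X *m zero_extend v^T = 0.
  apply: l2norm_eq0; apply/eqP; rewrite -sqrf_eq0; apply/eqP.
  rewrite -subcols_zero_extend -dotpvv.
  have -> : dotp (subcols X J *m v^T) (subcols X J *m v^T) =
      ((subcols X J *m v^T)^T *m (subcols X J *m v^T)) 0 0.
    by rewrite [in RHS]mxE; apply: eq_bigr => i _; rewrite [X in _ = X * _]mxE.
  by rewrite trmx_mul trmxK mulmxA -(mulmxA v) vG mul0mx mxE.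
have rE : restr J (zero_extend v^T) = zero_extend v^T.
  by apply: restrT => j; exact: zero_extend_notin.
move=> X0; have := hc (zero_extend v^T).
rewrite rE X0 [in X in _ <= X]l2norm_sqr big1 ?mul0r; last first.
  by move=> i _; rewrite mxE expr0n.
rewrite pmulr_rle0// => z0.
have /l2norm_eq0 z00 : l2norm (zero_extend v^T) = 0.
  by apply/eqP; rewrite -sqrf_eq0 eq_le z0 sqr_ge0.
apply: trmx_inj; rewrite (zero_extend_enum v^T) z00.
by apply/colP => k; rewrite !mxE.
Qed.

Lemma ols_notin (Y : 'cV[R]_n) (J : {set 'I_p}) j :
  j \notin J -> ols X Y J j 0 = 0.
Proof. exact: zero_extend_notin. Qed.

Lemma ols_normal_equations (Y : 'cV[R]_n) (J : {set 'I_p}) :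
  (subcols X J)^T *m subcols X J \in unitmx ->
  forall j, j \in J -> dotp (col j X) (Y - X *m ols X Y J) = 0.
Proof.
move=> GU j jJ; rewrite /ols -subcols_zero_extend; set XJ := subcols X J.
have e : XJ^T *m (Y - XJ *m (invmx (XJ^T *m XJ) *m (XJ^T *m Y))) = 0.
  by rewrite mulmxBr [X in _ - X]mulmxA [X in _ - X]mulmxA mulmxV// mul1mx
    subrr.
have := congr1 (fun A : 'cV[R]_#|J| => A (enum_rank_in jJ j) 0) e.
rewrite [X in _ = X -> _]mxE [X in X = _ -> _]mxE => <-; apply: eq_bigr => i _.
by rewrite !mxE enum_rankK_in.
Qed.

Hypothesis hX : forall j : 'I_p, l2norm (col j X) = Num.sqrt n%:R.

Lemma dotp_noise_le (J : {set 'I_p}) (u : 'cV[R]_p) (e : 'cV[R]_n) (nu : R) :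
  0 <= nu -> (forall j, `|dotp (col j X) e| / n%:R <= nu) ->
  `|dotp (X *m restr J u) e| / n%:R <=
  nu * (Num.sqrt #|J|%:R * l2norm (restr J u)).
Proof.
move=> nu0 he; have nR : 0 < n%:R :> R by rewrite ltr0n.
apply: (@le_trans _ _ (nu * \sum_(j in J) `|u j 0|)); last first.
  by rewrite ler_wpM2l// l2norm_restr l1_le_l2.
rewrite ler_pdivrMr// dotp_mulmx.
rewrite (@restr_sum _ _ J u (fun j x => x * dotp (col j X) e)) => [|j];
  last by rewrite mul0r.
apply: (le_trans (ler_norm_sum _ _ _)); rewrite mulrAC mulr_sumr.
apply: ler_sum => j _; rewrite normrM mulrC ler_wpM2r//.
by rewrite -ler_pdivrMr.
Qed.

(** The normal equations test the error [u] on I against the noise and the missed part [bD] only,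
    whose support is disjoint from I. Since theta < 1 - delta <= Lambda_min, this gives [U <= q + D]
    with [q] the noise term. The total error is U^2 + D^2 by disjointness, and (q + D)^2 <= 2 q^2 +
    2 D^2 yields the factors 2 and 3. *)
Lemma ols_error (beta : 'cV[R]_p) (e : 'cV[R]_n) (I : {set 'I_p})
    (s m : nat) (nu : R) :
  let delta := restricted_isometry X (2 * s) in
  let theta := restricted_orthogonality X s (2 * s) in
  0 <= theta -> delta + theta < 1 -> 0 <= nu ->
  (0 < m)%N -> (m <= 2 * s)%N -> (#|I| <= m)%N -> sparse s beta ->
  (forall j, `|dotp (col j X) e| / n%:R <= nu) ->
  (0 < p)%N ->
  l2norm (ols X (X *m beta + e) I - beta) ^+ 2 <=
  2 * (nu ^+ 2 * m%:R / Lambda_min X m ^+ 2) +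
  3 * l2norm (restr (~: I) beta) ^+ 2.
Proof.
move=> delta theta th0 dth nu0 m0 ms Im sb he p0.
have nR : 0 < n%:R :> R by rewrite ltr0n.
set L := Lambda_min X m.
have rip (J : {set 'I_p}) (v : 'cV[R]_p) : (#|J| <= 2 * s)%N ->
    (1 - delta) * l2norm (restr J v) ^+ 2 <= l2norm (X *m restr J v) ^+
      2 / n%:R.
  by move=> Js; have /andP[] := restricted_isometryP hX n0 v Js.
have suppE (v : 'cV[R]_p) : restr (supp v) v = v.
  by apply: restrT => j; rewrite inE negbK => /eqP.
have dL : 1 - delta <= L.
  apply: le_Lambda_min => // v vm; rewrite -(suppE v); apply: rip.
  exact: leq_trans ms.
have d0 : 0 < 1 - delta by lra.
have L0 : 0 < L by lra.
have GU : (subcols X I)^T *m subcols X I \in unitmx.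
  by apply: (gram_unit d0) => v; apply: rip; exact: leq_trans ms.
set bh := ols _ _ _.
have bhI j : j \notin I -> bh j 0 = 0 by exact: ols_notin.
have bhN : forall j, j \in I -> dotp (col j X) (X *m beta + e - X *m bh) = 0.
  exact: ols_normal_equations.
clearbody bh.
pose u := bh - restr I beta.
have uI : restr I u = u.
  by apply: restrT => j jI; rewrite !mxE (negbTE jI) subr0 bhI.
set bD := restr (~: I) beta.
have bE : beta = restr I beta + bD.
  by apply/colP => j; rewrite !mxE inE; case: (j \in I); rewrite ?addr0 ?add0r.
have bDE : bD = restr (supp beta :\: I) bD.
  apply/esym/restrT => j; rewrite !inE negb_and negbK mxE inE.
  by case: (j \in I) => //=; rewrite negbK => /eqP.
have XuE : dotp (X *m u) (X *m u) = dotp (X *m u) e + dotp (X *m u) (X *m bD).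
  rewrite -dotpDr !dotp_mulmx; apply: eq_bigr => j _.
  have [jI|jI] := boolP (j \in I); last by rewrite -uI mxE (negbTE jI) !mul0r.
  congr (_ * _); apply/eqP; rewrite eq_sym -subr_eq0 -dotpBr -(bhN j jI).
  apply/eqP; congr dotp.
  by rewrite /u {2}bE mulmxBr mulmxDr; apply/colP => i; rewrite !mxE; ring.
set U := l2norm u; set D := l2norm bD.
have U0 : 0 <= U by exact: l2norm_ge0.
have D0 : 0 <= D by exact: l2norm_ge0.
have h1 : L * U ^+ 2 <= l2norm (X *m u) ^+ 2 / n%:R.
  apply: Lambda_minP => //; apply: leq_trans Im; apply: subset_leq_card.
  apply/fintype.subsetP => j; rewrite inE; apply: contraR => jI.
  by rewrite -uI mxE (negbTE jI).
have h2 : `|dotp (X *m u) e| / n%:R <= nu * (Num.sqrt m%:R * U).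
  rewrite -uI; apply: (le_trans (dotp_noise_le I u nu0 he)).
  by rewrite uI ler_wpM2l// ler_wpM2r// ler_sqrt ?ler0n// ler_nat.
have h3 : `|dotp (X *m u) (X *m bD)| / n%:R <= theta * D * U.
  rewrite dotpC bDE -uI.
  have := @restricted_orthogonalityP _ _ _ X hX n0 s (2 * s)
    (supp beta :\: I) I bD u.
  rewrite -bDE uI; apply.
  - rewrite -finset.setI_eq0; apply/eqP/setP => j; rewrite !inE.
    by case: (j \in I); rewrite ?andbF.
  - by apply: leq_trans sb; rewrite subset_leq_card// finset.subsetDl.
  - exact: leq_trans ms.
have h4 : L * U <= nu * Num.sqrt m%:R + theta * D.
  have [->|Un0] := eqVneq U 0.
    by rewrite mulr0 addr_ge0// ?mulr_ge0.
  have Ug : 0 < U by rewrite lt_neqAle eq_sym Un0.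
  rewrite -(ler_pM2r Ug) -mulrA -expr2; apply: (le_trans h1).
  rewrite -dotpvv XuE mulrDl mulrDl -mulrA lerD//.
    by apply: le_trans h2; rewrite ler_pM2r ?invr_gt0// ler_norm.
  by apply: le_trans h3; rewrite ler_pM2r ?invr_gt0// ler_norm.
have h5 : U <= nu * Num.sqrt m%:R / L + D.
  have : L * U <= L * (nu * Num.sqrt m%:R / L + D).
    apply: (le_trans h4); rewrite mulrDr mulrCA divff ?gt_eqF// mulr1 lerD2l.
    by rewrite ler_wpM2r//; lra.
  by rewrite ler_pM2l.
have -> : bh - beta = u + - bD.
  by rewrite /u {1}bE opprD addrA.
have -> : l2norm (u - bD) ^+ 2 = U ^+ 2 + D ^+ 2.
  rewrite /U /D !l2norm_sqr -big_split; apply: eq_bigr => j _ /=.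
  rewrite -{1 2}uI !mxE inE; case: (j \in I); rewrite /=; ring.
set q := nu * Num.sqrt m%:R / L in h5.
have -> : nu ^+ 2 * m%:R / L ^+ 2 = q ^+ 2.
  by rewrite /q -{1}(sqr_sqrtr (ler0n R m)); field; rewrite gt_eqF.
have : U ^+ 2 <= (q + D) ^+ 2.
  by rewrite lerXn2r ?nnegrE// (le_trans U0).
have : 0 <= (q - D) ^+ 2 by exact: sqr_ge0.
by rewrite sqrrB sqrrD; lra.
Qed.
End ols.

(** * The Gauss-Dantzig selector *)

Section constants.
Variables (R : realType) (n p : nat) (X : 'M[R]_(n, p)).
Hypothesis hX : forall j : 'I_p, l2norm (col j X) = Num.sqrt n%:R.
Hypothesis n0 : (0 < n)%N.
Let nR : 0 < n%:R :> R. Proof. by rewrite ltr0n. Qed.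

Lemma l2norm_delta (j : 'I_p) : l2norm (delta_mx j 0 : 'cV[R]_p) = 1.
Proof.
rewrite /l2norm (bigD1 j)//= !mxE !eqxx expr1n big1 ?addr0 ?sqrtr1// => i ij.
by rewrite mxE (negbTE ij) expr0n.
Qed.

Lemma restr_delta (j : 'I_p) : restr [set j]%SET (delta_mx j 0 : 'cV[R]_p) =
  delta_mx j 0.
Proof. by apply: restrT => i; rewrite inE mxE => /negbTE ->. Qed.

Lemma l2norm_dim0 k (v : 'cV[R]_k) : k = 0 -> l2norm v = 0.
Proof.
move=> k0; subst k; by rewrite /l2norm big_ord0 sqrtr0.
Qed.

Lemma subcols_card0 (J : {set 'I_p}) (c : 'cV[R]_#|J|) :
  (#|J| <= 0)%N -> subcols X J *m c = 0.
Proof.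
move=> J0; apply/colP => i; rewrite !mxE big1// => l _.
by have := ltn_ord l; rewrite ltnNge (leq_trans J0).
Qed.

Lemma inf_setT : inf [set: R] = 0.
Proof.
apply: inf_out => -[_ [x xlb]]; have := xlb (x - 1) I; rewrite lerBrDr; lra.
Qed.

(** A single column has quotient exactly 1, which must be at most 1 + delta. For [m = 0] the
    constant is the default infimum 0. *)
Lemma restricted_isometry_ge0 m : (0 < p)%N -> 0 <= restricted_isometry X m.
Proof.
move=> p0; case: m => [|m].
  rewrite /restricted_isometry (_ : [set _ | _] = setT) ?inf_setT//.
  apply/seteqP; split => // d _ J v; rewrite leqn0 => /eqP J0.
  rewrite (l2norm_dim0 v J0) subcols_card0 ?J0// expr0n/= !mulr0.
  by rewrite l2norm_sqr big1 ?mul0r ?lexx// => i _; rewrite mxE expr0n.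
have j : 'I_p := Ordinal p0.
have c1 : (#|[set j]%SET| <= m.+1)%N by rewrite cards1.
have /andP[_] := restricted_isometryP hX n0 (delta_mx j 0) c1.
rewrite restr_delta l2norm_delta -colE (col_sqr hX) divff ?gt_eqF// expr1n
  mulr1.
by rewrite lerDl.
Qed.

Lemma restricted_orthogonality_ge0 m m' : (1 < p)%N ->
  0 <= restricted_orthogonality X m m'.
Proof.
move=> p1.
have dz (k : nat) (v : 'cV[R]_k) : dotp 0 v = 0.
  by rewrite /dotp big1// => i _; rewrite mxE mul0r.
have lz (J : {set 'I_p}) (c : 'cV[R]_#|J|) : (#|J| <= 0)%N -> l2norm c = 0.
  by rewrite leqn0 => /eqP J0; exact: l2norm_dim0.
case: m => [|m].
  rewrite /restricted_orthogonality (_ : [set _ | _] = setT) ?inf_setT//.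
  apply/seteqP; split => // d _ J J' c c' _ J0 _.
  by rewrite subcols_card0// dz normr0 mul0r (lz J)// mulr0 mul0r.
case: m' => [|m'].
  rewrite /restricted_orthogonality (_ : [set _ | _] = setT) ?inf_setT//.
  apply/seteqP; split => // d _ J J' c c' _ _ J0.
  by rewrite dotpC subcols_card0// dz normr0 mul0r (lz J')// mulr0.
pose i := Ordinal (ltnW p1); pose j := Ordinal p1.
have ij : [disjoint [set i]%SET & [set j]%SET]%B by rewrite disjoints1 inE.
have c1 : (#|[set i]%SET| <= m.+1)%N by rewrite cards1.
have c2 : (#|[set j]%SET| <= m'.+1)%N by rewrite cards1.
have := restricted_orthogonalityP hX n0 (delta_mx i 0) (delta_mx j 0) ij c1 c2.
rewrite !restr_delta !l2norm_delta !mulr1; apply: le_trans.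
by rewrite divr_ge0.
Qed.

Lemma C0'_ge0 (delta theta : R) : 0 <= delta -> 0 <= theta ->
  0 < 1 - delta - theta -> 0 <= C0' delta theta.
Proof.
move=> d0 t0 x0; have := C0'_lower_bound d0 t0 x0 => h.
rewrite -(pmulr_rge0 _ x0); apply: le_trans h.
have : 0 <= theta * (1 + delta) by rewrite mulr_ge0//; lra.
by have := sqrtr_ge0 (2 : R); lra.
Qed.

Lemma C0'_le_C1 (delta theta : R) : 0 <= delta -> 0 < 1 - delta - theta ->
  C0' delta theta <= C1 delta theta.
Proof. by move=> d0 x0; rewrite /C1 lerDl divr_ge0 ?(ltW x0)//; lra. Qed.

(** Gives 2 ln p >= 1, which allows the factor 2 ln p to be taken out of the minima in the oracle
    bound. *)
Lemma half_le_ln (k : nat) : (1 < k)%N -> 1 / 2 <= ln k%:R :> R.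
Proof.
move=> k1; have k0 : 0 < k%:R :> R by rewrite ltr0n (ltn_trans _ k1).
rewrite -ler_expR lnK//.
apply: (@le_trans _ _ 2); last by rewrite ler_nat.
have := expR_ge1Dx (- (1 / 2) : R); rewrite expRN => h.
have e0 : 0 < expR (1 / 2) :> R by exact: expR_gt0.
have h2 : 1 / 2 <= (expR (1 / 2))^-1 :> R by apply: le_trans h; lra.
have : 1 / 2 * expR (1 / 2) <= 1 :> R by rewrite -ler_pdivlMr// [X in _ <=
  X]div1r.
lra.
Qed.

Lemma ols_set0 (Y : 'cV[R]_n) : ols X Y finset.set0 = 0.
Proof. by apply/colP => j; rewrite ols_notin ?mxE// finset.in_set0. Qed.

Lemma gauss_dantzig_bound (beta b : 'cV[R]_p) (e : 'cV[R]_n) (s s0 : nat)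
    (sigma tau a C4 t0 : R) :
  let delta := restricted_isometry X (2 * s) in
  let theta := restricted_orthogonality X s (2 * s) in
  let lam := dantzig_level n p a tau in
  let beta_hat := ols X (X *m beta + e) (thresholded_set b t0) in
  (1 < p)%N -> 0 < sigma -> 0 < tau -> 0 < a ->
  is_essential_sparsity n beta sigma s0 -> sparse s beta ->
  (forall j, `|dotp (col j X) e| / n%:R <=
     Num.sqrt (1 + a) * (universal_level R n p * sigma)) ->
  dantzig_selector X (X *m beta + e) (lam * sigma) b ->
  delta + theta < 1 - tau -> C1 delta theta < C4 ->
  C1 delta theta * lam * sigma < t0 -> t0 <= C4 * lam * sigma ->
  [/\ (#|supp beta_hat| <= 2 * s0)%N,
      (#|supp beta_hat :\: supp beta| <= s0)%N,
      (s0 <= s)%N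
    & l2norm (beta_hat - beta) ^+ 2 <=
        2 * C3_sq delta theta a tau C4 (Lambda_min X (2 * s0)) * ln p%:R *
        (sigma ^+ 2 / n%:R
         + \sum_(i < p) Num.min (beta i 0 ^+ 2) (sigma ^+ 2 / n%:R))].
Proof.
move=> delta theta lam beta_hat p1 sg0 tau0 a0 [cond condmin] sb he hb dth C14
  t0l t0u.
have p0 : (0 < p)%N by exact: ltnW.
have d0 : 0 <= delta by exact: restricted_isometry_ge0.
have th0 : 0 <= theta by exact: restricted_orthogonality_ge0.
have x0 : 0 < 1 - delta - theta by lra.
have C0p := C0'_ge0 d0 th0 x0; have C01 := C0'_le_C1 d0 x0.
have lnp := half_le_ln p1.
have lnp0 : 0 < ln p%:R :> R by lra.
pose l0 := universal_level R n p * sigma.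
have u0 : 0 < universal_level R n p by rewrite sqrtr_gt0 divr_gt0// mulr_gt0.
have l00 : 0 < l0 by rewrite mulr_gt0.
have l02 : l0 ^+ 2 = 2 * ln p%:R * (sigma ^+ 2 / n%:R).
  rewrite /l0 exprMn sqr_sqrtr ?divr_ge0 ?mulr_ge0 ?(ltW lnp0)//; ring.
have bnd : universal_level R n p ^+ 2 * sigma ^+ 2 = l0 ^+ 2 by rewrite exprMn.
rewrite bnd in cond condmin.
pose nu := Num.sqrt (1 + a) * l0.
have nu0 : 0 <= nu by rewrite mulr_ge0 ?sqrtr_ge0 ?ltW.
have nu2 : nu ^+ 2 = (1 + a) * l0 ^+ 2 by rewrite exprMn sqr_sqrtr//; lra.
have lamE : lam * sigma = nu + l0 / tau.
  by rewrite /lam /dantzig_level /nu /l0; field; exact: lt0r_neq0.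
have lnge0 : 0 <= lam * sigma by rewrite lamE addr_ge0// divr_ge0// ltW.
have l0ln : l0 <= lam * sigma.
  rewrite lamE; have : l0 <= l0 / tau by rewrite ler_pdivlMr// ler_piMr ?ltW//;
    lra.
  lra.
have t00 : 0 < t0.
  apply: le_lt_trans t0l; rewrite -mulrA mulr_ge0//; exact: le_trans C01.
have C4p : 0 <= C4 by lra.
have th1 : delta + theta < 1 by lra.
have min_ge0 (x y : R) : 0 <= y -> 0 <= Num.min (x ^+ 2) y.
  by move=> y0; rewrite le_min sqr_ge0.
have sn0 : 0 <= sigma ^+ 2 / n%:R by rewrite divr_ge0 ?sqr_ge0.
have C3p : 0 <= C3_sq delta theta a tau C4 (Lambda_min X (2 * s0)).
  apply: addr_ge0; last by rewrite divr_ge0 ?sqr_ge0// mulr_ge0//; lra.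
  apply: mulr_ge0; first by rewrite mulr_ge0// sqr_ge0.
  by rewrite addr_ge0// sqr_ge0.
have supp_min : \sum_(i < p) Num.min (beta i 0 ^+ 2) (l0 ^+ 2) =
    \sum_(i in supp beta) Num.min (beta i 0 ^+ 2) (l0 ^+ 2).
  rewrite (bigID (mem (supp beta)))/= [X in _ + X]big1 ?addr0// => i.
  rewrite inE negbK => /eqP ->; rewrite expr0n/= min_l// sqr_ge0//.
(* Each support coordinate contributes at most [l0 ^+ 2], so the support size satisfies the
   condition that s0 minimises. *)
have s0S : (s0 <= #|supp beta|)%N.
  apply: condmin; rewrite supp_min mulr_natl -sumr_const; apply: ler_sum => i _.
  by rewrite ge_min lexx orbT.
have s0s : (s0 <= s)%N by exact: leq_trans sb.
have bhI j : j \notin thresholded_set b t0 -> beta_hat j 0 = 0 by exact: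
  ols_notin.
have suppI : supp beta_hat \subset thresholded_set b t0.
  apply/fintype.subsetP => j; rewrite inE; apply: contraR => jI.
  by rewrite bhI.
(* By minimality [s0.-1] violates the condition, so s0 [l0 ^+ 2] exceeds the sum of minima by at
   most one [l0 ^+ 2]; this is the source of the term sigma^2 / n. *)
have oracle : s0%:R * l0 ^+ 2 <= 2 * ln p%:R * (sigma ^+ 2 / n%:R
         + \sum_(i < p) Num.min (beta i 0 ^+ 2) (sigma ^+ 2 / n%:R)).
  have h1 : \sum_(i < p) Num.min (beta i 0 ^+ 2) (l0 ^+ 2) <=
      2 * ln p%:R * \sum_(i < p) Num.min (beta i 0 ^+ 2) (sigma ^+ 2 / n%:R).
    rewrite mulr_sumr; apply: ler_sum => i _.
    rewrite l02 [X in _ <= _ * X]minElt; case: ifP => _; rewrite ge_min.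
      by rewrite ler_peMl ?sqr_ge0//; lra.
    by rewrite lexx orbT.
  rewrite mulrDr -l02.
  have [s0z|s0p] := posnP s0.
    rewrite s0z mul0r addr_ge0 ?sqr_ge0//; apply: le_trans h1.
    by apply: sumr_ge0 => i _; rewrite min_ge0 ?sqr_ge0.
  have : ~ (\sum_(i < p) Num.min (beta i 0 ^+ 2) (l0 ^+ 2) <= s0.-1%:R * l0 ^+
    2).
    by move=> /condmin; rewrite leqNgt ltn_predL s0p.
  move=> /negP; rewrite -ltNge => h2.
  have -> : s0%:R = s0.-1%:R + 1 :> R by rewrite natr1 prednK.
  rewrite mulrDl mul1r; lra.
suff [cI1 cI2 err] : [/\ (#|thresholded_set b t0| <= 2 * s0)%N,
    (#|thresholded_set b t0 :\: supp beta| <= s0)%N &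
    l2norm (beta_hat - beta) ^+ 2 <=
      C3_sq delta theta a tau C4 (Lambda_min X (2 * s0)) * (s0%:R * l0 ^+ 2)].
  split => //.
  - exact: leq_trans (subset_leq_card suppI) cI1.
  - by apply: leq_trans cI2; rewrite subset_leq_card// finset.setSD.
  - apply: (le_trans err); rewrite (mulrC 2) -(mulrA _ 2) -mulrA.
    by rewrite ler_wpM2l.
(* If s0 = 0 then [beta = 0], so 0 is feasible on the noise event and [b = 0]: a positive threshold
   selects nothing. Otherwise the cone bound applies. *)
have [s0z|s0p] := posnP s0.
  have beta0 : beta = 0.
    apply/colP => i; rewrite mxE; apply/eqP; rewrite -sqrf_eq0; apply/eqP.
    move: cond; rewrite s0z mul0r => cond.
    have : \sum_(i < p) Num.min (beta i 0 ^+ 2) (l0 ^+ 2) = 0.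
      apply/eqP; rewrite eq_le cond sumr_ge0// => k _.
      by rewrite min_ge0 ?sqr_ge0.
    move=> /(psumr_eq0P (fun k (_ : true) =>
      min_ge0 (beta k 0) _ (sqr_ge0 l0))).
    by move=> /(_ i isT); rewrite minElt; case: ifP => // _ /eqP;
      rewrite sqrf_eq0 gt_eqF.
  have b0 : b = 0.
    have fe : dantzig_feasible X (X *m beta + e) (lam * sigma) 0.
      apply/(dantzig_feasibleP _ _ _ lnge0) => j.
      rewrite beta0 !mulmx0 add0r subr0; apply: (le_trans (he j)).
      by rewrite lamE -/l0 -/nu lerDl divr_ge0// ltW.
    have := hb.2 _ fe.
    have -> : l1norm (0 : 'cV[R]_p) = 0.
      by rewrite /l1norm big1// => i _; rewrite mxE normr0.
    move=> b0; have : l1norm b = 0 by apply/eqP; rewrite eq_le b0 sumr_ge0.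
    move=> /(psumr_eq0P (fun k (_ : true) => normr_ge0 (b k 0))) z.
    by apply/colP => i; rewrite mxE; apply/eqP; rewrite -normr_eq0 z.
  have I0 : thresholded_set b t0 = finset.set0.
    by apply/setP => j; rewrite !inE b0 mxE normr0 leNgt t00.
  rewrite /beta_hat I0 ols_set0 beta0 subr0 s0z mul0r mulr0 finset.set0D cards0.
  split => //; rewrite l2norm_sqr big1// => i _; by rewrite mxE expr0n.
have [T0 [T0S T0c T0top]] := exists_largest (fun j => `|beta j 0|) s0S.
(* A larger coordinate outside T0 would, with T0, give s0 + 1 terms equal to [l0 ^+ 2] in the sum of
   minima. *)
have small j : j \notin T0 -> beta j 0 ^+ 2 <= l0 ^+ 2.
  move=> jT; have [jS|] := boolP (j \in supp beta); last first.
    by rewrite inE negbK => /eqP ->; rewrite expr0n sqr_ge0.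
  rewrite leNgt; apply/negP => jl.
  have jD : j \in supp beta :\: T0 by rewrite finset.in_setD jT.
  have : (s0.+1)%:R * l0 ^+ 2 <= s0%:R * l0 ^+ 2.
    apply: le_trans cond.
    have cj : #|j |: T0| = s0.+1 by rewrite cardsU1 jT T0c.
    rewrite -cj mulr_natl -sumr_const [leRHS](bigID (mem (j |: T0)%SET))/=.
    rewrite -[leLHS]addr0 lerD//; last first.
      by apply: sumr_ge0 => i _; rewrite min_ge0 ?sqr_ge0.
    apply: ler_sum => i; rewrite finset.in_setU1 le_min lexx andbT.
    move=> /orP[/eqP ->|iT]; first exact: ltW.
    apply: (le_trans (ltW jl)); rewrite -(real_normK (num_real (beta j 0))).
    rewrite -(real_normK (num_real (beta i 0))) lerXn2r ?nnegrE//.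
    exact: T0top.
  by rewrite ler_pM2r ?exprn_gt0// ler_nat ltnn.
have tail : \sum_(j in ~: T0) beta j 0 ^+ 2 <= s0%:R * l0 ^+ 2.
  apply: le_trans cond; rewrite [leRHS](bigID (mem (~: T0)))/=.
  rewrite -[leLHS]addr0 lerD//.
    by apply: ler_sum => j; rewrite inE => jT; rewrite le_min lexx small.
  by apply: sumr_ge0 => i _; rewrite min_ge0 ?sqr_ge0.
rewrite -/l0 -/nu in he; rewrite lamE in hb.
have [T1 [T1s T1c T1or T1top hN]] :=
  dantzig_cone_bound hX n0 d0 th0 tau0 dth l00 nu0 s0p s0s sb T0c tail he hb.
rewrite -/delta -/theta -lamE in hN.
set h := b - restr T0 beta in T1top hN.
pose sq := Num.sqrt s0%:R : R.
have sq0 : 0 < sq by rewrite sqrtr_gt0 ltr0n.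
have sqE : sq ^+ 2 = s0%:R by rewrite sqr_sqrtr.
set N := Num.sqrt _ in hN.
have N0 : 0 <= N by exact: sqrtr_ge0.
have N2 : N ^+ 2 = \sum_(j in T0 :|: T1) h j 0 ^+ 2.
  by rewrite sqr_sqrtr// sumr_ge0// => j _; exact: sqr_ge0.
have sumT (A : {set 'I_p}) : A \subset T0 :|: T1 -> \sum_(j in A) h j 0 ^+ 2 <=
  N ^+ 2.
  move=> AT; rewrite N2 [leRHS](big_setID A)/= (finset.setIidPr AT) lerDl.
  by apply: sumr_ge0 => j _; exact: sqr_ge0.
have hE j : h j 0 = b j 0 - (if j \in T0 then beta j 0 else 0) by rewrite !mxE.
set I := thresholded_set b t0.
have Nt0 : N < sq * t0.
  apply: (le_lt_trans hN); rewrite mulrC ltr_pM2l//; apply: le_lt_trans t0l.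
  by rewrite -[leRHS]mulrA ler_wpM2r.
(* A selected coordinate outside T0 and T1 would force all s0 entries of [h] on T1 to be at least
   [t0], hence [N >= sq * t0]. *)
have IT : I :\: T0 \subset T1.
  apply/fintype.subsetP => j; rewrite finset.in_setD => /andP[jT jI].
  apply/negPn/negP => jT1.
  have jD : j \in ~: T0 :\: T1 by rewrite finset.in_setD jT1 finset.in_setC.
  have [T1E|T1E] := T1or; first by move: jT1; rewrite T1E finset.in_setC jT.
  suff : (sq * t0) ^+ 2 <= N ^+ 2.
    rewrite ler_pXn2r ?nnegrE ?mulr_ge0 ?(ltW sq0) ?(ltW t00)//.
    by rewrite leNgt Nt0.
  apply: le_trans (sumT T1 (finset.subsetUr _ _)).
  rewrite exprMn sqE -T1E mulr_natl -sumr_const; apply: ler_sum => i iT.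
  rewrite -(real_normK (num_real (h i 0))) lerXn2r ?nnegrE ?(ltW t00)//.
  apply: le_trans (T1top _ _ iT jD); rewrite hE (negbTE jT) subr0.
  by move: jI; rewrite inE.
have cI : (#|I :\: T0| <= s0)%N by exact: leq_trans (subset_leq_card IT) T1c.
have cI2 : (#|I| <= 2 * s0)%N.
  rewrite -(cardsID T0 I) mul2n -addnn leq_add//.
  by rewrite -T0c subset_leq_card// finset.subsetIr.
split => //.
  by apply: leq_trans cI; rewrite subset_leq_card// finset.setDS.
have m0 : (0 < 2 * s0)%N by rewrite muln_gt0.
have ms : (2 * s0 <= 2 * s)%N by rewrite leq_mul2l.
have := ols_error n0 hX th0 th1 nu0 m0 ms cI2 sb he p0;
  rewrite -/beta_hat => oe.
apply: (le_trans oe); set L := Lambda_min X (2 * s0).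
(* On T0 a missed coordinate has [b] below [t0], so that of [beta] is at most that of [h] plus [t0]
   in absolute value; the l2 bounds C0' and C4 add up. Outside T0 the tail bound gives the extra 1
   in [C3_sq]. *)
have missed : l2norm (restr (~: I) beta) ^+ 2 <=
    s0%:R * (((C0' delta theta + C4) * (lam * sigma)) ^+ 2 + (lam * sigma) ^+
      2).
  rewrite l2norm_restr sqr_sqrtr; last by apply: sumr_ge0 => j _;
    exact: sqr_ge0.
  rewrite (big_setID T0)/= mulrDr lerD//; last first.
    apply: (@le_trans _ _ (s0%:R * l0 ^+ 2)); last first.
      by rewrite ler_wpM2l// lerXn2r ?nnegrE// ltW.
    apply: le_trans tail; rewrite [leRHS](big_setID (~: I :\: T0))/=.
    have -> : ~: T0 :&: (~: I :\: T0) = ~: I :\: T0.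
      by apply/setP => j; rewrite !inE; case: (j \in T0).
    by rewrite lerDl sumr_ge0// => j _; exact: sqr_ge0.
  apply: (@le_trans _ _ (\sum_(j in T0) (`|h j 0| + t0) ^+ 2)).
    rewrite [leRHS](big_setID (~: I))/= finset.setIC -[leLHS]addr0 lerD//;
      last first.
      by apply: sumr_ge0 => j _; exact: sqr_ge0.
    apply: ler_sum => j; rewrite !inE -ltNge => /andP[jT jI].
    rewrite -(real_normK (num_real (beta j 0))) lerXn2r ?nnegrE ?addr_ge0 ?(ltW
      t00)//.
    have := ler_normB (b j 0) (h j 0); rewrite {1}hE jT opprB subrKC.
    by lra.
  have hT0 : \sum_(j in T0) `|h j 0| <= sq * N.
    apply: (le_trans (l1_le_l2 _ _)); rewrite T0c ler_pM2l//.
    rewrite -(ger0_norm N0) -sqrtr_sqr ler_sqrt ?sqr_ge0//.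
    by apply: sumT; exact: finset.subsetUl.
  have -> : \sum_(j in T0) (`|h j 0| + t0) ^+ 2 =
      \sum_(j in T0) h j 0 ^+ 2 + 2 * t0 * \sum_(j in T0) `|h j 0| +
        s0%:R * t0 ^+ 2.
    have -> : s0%:R * t0 ^+ 2 = \sum_(j in T0) t0 ^+ 2.
      by rewrite sumr_const T0c mulr_natl.
    rewrite mulr_sumr -!big_split/=.
    by apply: eq_bigr => j _; rewrite -[in RHS](real_normK (num_real (h j 0)));
      ring.
  have h1 : N + sq * t0 <= sq * ((C0' delta theta + C4) * (lam * sigma)).
    have : sq * t0 <= sq * (C4 * lam * sigma) by rewrite ler_pM2l.
    move: hN; rewrite -/sq; set ls := lam * sigma; rewrite -(mulrA C4) -/ls.
    by clearbody ls; lra.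
  apply: (@le_trans _ _ ((N + sq * t0) ^+ 2)).
    have := sumT T0 (finset.subsetUl _ _).
    have : 2 * t0 * \sum_(j in T0) `|h j 0| <= 2 * t0 * (sq * N).
      by rewrite ler_wpM2l// mulr_ge0// ltW.
    rewrite -sqE sqrrD exprMn; lra.
  have Nt_ge0 : 0 <= N + sq * t0 by rewrite addr_ge0// mulr_ge0// ltW.
  rewrite -sqE -exprMn lerXn2r ?nnegrE//.
  exact: le_trans h1.
have ls2 : (lam * sigma) ^+ 2 = (Num.sqrt (1 + a) + tau^-1) ^+ 2 * l0 ^+ 2.
  by rewrite /lam /dantzig_level /l0; ring.
move: missed; rewrite exprMn ls2 nu2 /C3_sq -/L => missed.
(* The 4 in [C3_sq] is the factor 2 of the least squares error times the 2 of the model size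
   [2 * s0]. *)
have -> : 2 * ((1 + a) * l0 ^+ 2 * (2 * s0)%:R / L ^+ 2) =
    4 * (1 + a) / L ^+ 2 * (s0%:R * l0 ^+ 2) by rewrite natrM; ring.
move: missed; set Q := (C0' _ _ + C4) ^+ 2; set W := _ ^+ 2 * l0 ^+ 2.
have -> : (3 * (Num.sqrt (1 + a) + tau^-1) ^+ 2 * (Q + 1) + 4 * (1 + a) / L ^+
  2) * (s0%:R * l0 ^+ 2) =
   4 * (1 + a) / L ^+ 2 * (s0%:R * l0 ^+ 2) + 3 * (s0%:R * (Q * W +
     W)) by rewrite /W; ring.
by rewrite lerD2l ler_pM2l.
Qed.

End constants.

Theorem theorem1p2 (R : realType) (d : measure_display) (T : measurableType d)
    (P : probability T R) (n p : nat) (X : 'M[R]_(n, p)) (beta : 'cV[R]_p)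
    (eps : 'I_n -> {RV P >-> R}) (sigma tau a : R) (s s0 : nat) (C4 t0 : R)
    (beta_init : T -> 'cV[R]_p)
    (hnp : (n <= p)%N)
    (hX : forall j : 'I_p, l2norm (col j X) = Num.sqrt n%:R)
    (hsigma : 0 < sigma)
    (heps : isotropic_gaussian eps sigma)
    (htau : 0 < tau) (ha : 0 < a)
    (hs0 : is_essential_sparsity n beta sigma s0)
    (hinit : forall w : T,
       dantzig_selector X (response X beta eps w)
         (dantzig_level n p a tau * sigma) (beta_init w))
    (hbeta : sparse s beta) :
  let delta := restricted_isometry X (2 * s) in
  let theta := restricted_orthogonality X s (2 * s) in
  let lam := dantzig_level n p a tau in
  delta + theta < 1 - tau ->
  C1 delta theta < C4 ->
  C1 delta theta * lam * sigma < t0 ->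
  t0 <= C4 * lam * sigma ->
  let S := supp beta in
  let beta_hat (w : T) :=
    ols X (response X beta eps w) (thresholded_set (beta_init w) t0) in
  let C3sq := C3_sq delta theta a tau C4 (Lambda_min X (2 * s0)) in
  prob_at_least P
    [set w : T |
      [/\ (#|supp (beta_hat w)| <= 2 * s0)%N,
          (#|supp (beta_hat w) :\: S| <= s0)%N,
          (s0 <= s)%N
        & l2norm (beta_hat w - beta) ^+ 2
            <= 2 * C3sq * ln p%:R *
               (sigma ^+ 2 / n%:R
                + \sum_(i < p) Num.min (beta i 0 ^+ 2) (sigma ^+ 2 / n%:R))]]
    (1 - (Num.sqrt (pi * ln p%:R) * p%:R `^ a)^-1).
Proof.
move=> delta theta lam dth C14 t0l t0u S beta_hat C3sq.
(* An admissible threshold exists only if lam is nonzero, which excludes n = 0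
   and p <= 1. *)
have lam0 : lam != 0.
  apply: contraTneq (lt_le_trans t0l t0u) => ->.
  by rewrite !mulr0 !mul0r ltxx.
have n0 : (0 < n)%N.
  rewrite lt0n; apply: contraNneq lam0 => n0.
  by rewrite /lam /dantzig_level /universal_level n0 invr0 mulr0 sqrtr0 mulr0.
have p1 : (1 < p)%N.
  rewrite ltnNge; apply: contra lam0 => p1; have lnp : ln p%:R <= 0 :> R.
    by case: (p) p1 => [|[|//]] _; [rewrite ln0|rewrite ln1].
  rewrite /lam /dantzig_level /universal_level [Num.sqrt (_ / _)]ler0_sqrtr
    ?mulr0//.
  by rewrite mulr_le0_ge0 ?invr_ge0// mulr_ge0_le0.
(* The event depends on the noise alone, and the bounds hold at each of its points for whichever
   minimiser was chosen there. *)
have [A [mA Asub PA]] := noise_event hX n0 p1 hsigma ha heps.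
exists A; split => // w /Asub /= noise.
exact: (gauss_dantzig_bound hX n0 p1 hsigma htau ha hs0 hbeta noise (hinit w)
  dth C14 t0l t0u).
Qed.
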